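(* If $d=2$, then $\lim_{L\to\infty}\mathbb{E}_{\nu_L}R=\infty$.
   Context: Let $d=2$ and $V(L)=[-L,L]^2\cap\mathbb{Z}^2$; $o$ is the origin and $|\cdot|$ the Euclidean norm. A sandpile on $V(L)$ is a map $\eta:V(L)\to\{0,1,2,\dots\}$; it is stable if $\eta(x)<4$ for all $x$. If $\eta(x)\ge4$, then $x$ may topple: $\eta(x)$ decreases by $4$ and each nearest neighbour of $x$ in $V(L)$ receives one particle (particles sent outside $V(L)$ are lost). Carrying out all possible topplings in any order yields a unique stable sandpile (the stabilization), and the number of times each vertex topples does not depend on the order. The sandpile Markov chain on $V(L)$ has state space the stable sandpiles; at each step a particle is added at a uniformly chosen vertex and the sandpile is stabilized. $\nu_L$ is its unique stationary distribution. For a stable sandpile $\eta$ on $V(L)$, $R=R(\eta)=\sup\{|z|: z \text{ topples in the stabilization of }\eta+\mathbf{1}_o\}$ (with $R=0$ if nothing topples). *)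

(* Defs.v *)
From mathcomp Require Import all_boot all_order all_algebra.
From mathcomp Require Import boolp reals.

Set Implicit Arguments.
Unset Strict Implicit.
Unset Printing Implicit Defensive.

Import Order.TTheory GRing.Theory Num.Theory.
Local Open Scope ring_scope.

(* The box [-L, L]^2 /\ Z^2.  The vertex with indices (i, j) is the lattice   *)
(* point (i - L, j - L), so that the origin has indices (L, L).               *)
Definition box (L : nat) : finType := ('I_(L.*2).+1 * 'I_(L.*2).+1)%type.

Definition coord1 L (x : box L) : int := (x.1 : nat)%:Z - L%:Z.
Definition coord2 L (x : box L) : int := (x.2 : nat)%:Z - L%:Z.

Definition origin L : box L := (inord L, inord L).

Lemma coord_origin L : coord1 (origin L) = 0 /\ coord2 (origin L) = 0.
Proof.
have hL : (L < (L.*2).+1)%N by rewrite ltnS -addnn leq_addr.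
by rewrite /coord1 /coord2 /= inordK // subrr.
Qed.

Definition eucl_norm (R : realType) L (x : box L) : R :=
  Num.sqrt ((coord1 x)%:~R ^+ 2 + (coord2 x)%:~R ^+ 2).

Definition neighbour L (x y : box L) : bool :=
  `|coord1 x - coord1 y| + `|coord2 x - coord2 y| == 1.

Definition sandpile (L : nat) := {ffun box L -> nat}.

Definition is_stable L (eta : sandpile L) : bool :=
  [forall x, (eta x < 4)%N].

(* The finite type of stable sandpiles, and its inclusion in the sandpiles.   *)
Definition stable_sandpile (L : nat) : finType := {ffun box L -> 'I_4}.

Definition to_sandpile L (eta : stable_sandpile L) : sandpile L :=
  [ffun x => eta x : nat].

Definition add_particle L (x : box L) (eta : sandpile L) : sandpile L :=
  [ffun y => (eta y + (y == x))%N].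

Definition topple L (x : box L) (eta : sandpile L) : sandpile L :=
  [ffun y => if y == x then (eta y - 4)%N else (eta y + neighbour x y)%N].

Fixpoint topple_seq L (eta : sandpile L) (s : seq (box L)) : sandpile L :=
  if s is x :: s' then topple_seq (topple x eta) s' else eta.

Fixpoint legal L (eta : sandpile L) (s : seq (box L)) : bool :=
  if s is x :: s' then (4 <= eta x)%N && legal (topple x eta) s' else true.

Definition stabilizing L (eta : sandpile L) (s : seq (box L)) : bool :=
  legal eta s && is_stable (topple_seq eta s).

(* By the abelian property neither of the next two predicates depends on the  *)
(* stabilizing sequence s.                                                    *)
Definition stabilizes_to L (eta : sandpile L) (xi : stable_sandpile L) : Prop :=
  exists2 s, stabilizing eta s & topple_seq eta s = to_sandpile xi.

Definition topples_in_stabilization L (eta : sandpile L) (z : box L) : Prop :=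
  exists2 s, stabilizing eta s & z \in s.

Definition transition (R : realType) L (eta xi : stable_sandpile L) : R :=
  \sum_(x : box L | `[< stabilizes_to (add_particle x (to_sandpile eta)) xi >])
    #|box L|%:R^-1.

Definition is_distribution (R : realType) (T : finType) (mu : T -> R) : Prop :=
  (forall t, 0 <= mu t) /\ \sum_(t : T) mu t = 1.

Definition is_stationary (R : realType) L (nu : stable_sandpile L -> R) : Prop :=
  is_distribution nu /\
  forall xi, \sum_(eta : stable_sandpile L) nu eta * transition R eta xi = nu xi.

Definition finite_expectation (R : realType) (T : finType) (mu X : T -> R) : R :=
  \sum_(t : T) mu t * X t.

(* The base value 0 of the maximum is the radius when nothing topples.        *)
Definition avalanche_radius (R : realType) L (eta : stable_sandpile L) : R :=
  \big[Num.max/0]_(z : box L |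
      `[< topples_in_stabilization
            (add_particle (origin L) (to_sandpile eta)) z >]) eucl_norm R z.

(* Main.v *)
From mathcomp Require Import boolp classical_sets reals topology normedtype sequences.
Require Import Defs.
From mathcomp Require Import all_boot all_order all_algebra.
From mathcomp Require Import zify ring lra.

Set Implicit Arguments.
Unset Strict Implicit.
Unset Printing Implicit Defensive.

Import Order.TTheory GRing.Theory Num.Theory.

(** The expected radius diverges because the gradient of the Green function of
    the box is at most the probability of a large avalanche, while that
    gradient at distance k from the origin is of order 1/k.

    Let A be the Dirichlet Laplacian of the box (4 on the diagonal, -1 between
    neighbours), o the origin, rec the number of recurrent sandpiles, and
    T(z, y) = rec * A^-1(z, y).  A stationary distribution is uniform on the
    recurrent sandpiles ([nu_uniform]), so that probabilities are counts.

    The avalanche started by a particle at o is a succession of waves; in each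
    of them o topples once and every other vertex at most once.  The waves from
    z are encoded by the recurrent configurations of the box in which z is an
    additional sink, and those through y number T(z, y): this follows from the
    fact that toppling a wave permutes these configurations
    ([wave_count_harmonic], [wave_count_root]).  The number of waves from z that
    topple exactly the set W does not depend on the choice of z in W
    ([recurrent_configs_card_root]).  Hence, if e is a neighbour of o, then
    T(o, y) - T(e, y) is at most the number of waves from o that contain y but
    not e ([wave_count_le]).  After such a wave o is stable, so it is the last
    wave of an avalanche, and distinct such waves end distinct avalanches.  This
    gives ([wave_count_gap])
      T(o, y) - T(e, y) <= number of recurrent sandpiles for which y topples
                           when a particle is added at o.
    For y <> o the four left-hand sides add up to 0, because T is symmetric and
    A T(y, .) vanishes at o.  So their absolute values are bounded in the same
    way, up to a factor 3 ([potential_gap_abs]).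

    For the lower bound, let g be supported in the sup-norm ball of radius m.
    Then sum_y (A g)(y) (T(o, y) - T(e, y)) = rec * (g(o) - g(e)).  There is a
    smooth bump g, odd in the first coordinate, with g(e) of order 1 and A g of
    order 1/m.  With q_k the probability that the avalanche reaches sup-norm
    distance k, this yields ([weighted_tail_ge])
      sum_(k <= m) k q_k >= c m   for all m <= L.
    Summation by parts turns these inequalities into
      E R >= sum_(k <= L) q_k >= c sum_(m <= L) 1/(m + 1),
    and the harmonic series diverges. *)

(** * Recurrent configurations and waves on a finite graph *)

Section Graph.
Variables (V : finType) (adj : rel V).
Hypotheses (adj_sym : symmetric adj) (adj_irr : irreflexive adj).
Implicit Types (U W B : {set V}) (x y z : V) (f d : V -> nat).

Definition deg U x : nat := \sum_(y in U) adj x y.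

Lemma setU_setD U W : W :|: (U :\: W) = W :|: U.
Proof. by apply/setP => x; rewrite !inE; case: (x \in W). Qed.

Lemma degS U W x : U \subset W -> deg U x <= deg W x.
Proof.
move=> sUW; rewrite /deg [leqRHS](big_setID U) /= (setIidPr sUW).
exact: leq_addr.
Qed.

Lemma degID U W x : deg W x = deg (W :&: U) x + deg (W :\: U) x.
Proof. exact: big_setID. Qed.

Lemma degDS U W x : U \subset W -> deg W x = deg U x + deg (W :\: U) x.
Proof. by move=> sUW; rewrite (degID U) (setIidPr sUW). Qed.

Lemma degU1 U x : deg (x |: U) x = deg U x.
Proof.
case xU: (x \in U); first by rewrite (setUidPr _) ?sub1set.
by rewrite /deg big_setU1 ?xU //= adj_irr.
Qed.

Lemma degD1 U x : deg (U :\ x) x = deg U x.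
Proof.
case xU: (x \in U); first by rewrite -[in RHS](setD1K xU) degU1.
by rewrite (setDidPl _) // disjoint_sym disjoints1 xU.
Qed.

Lemma deg_le_U U W x : deg (W :|: U) x <= deg W x + deg (U :\: W) x.
Proof. by rewrite (degDS _ (subsetUl W U)) setDUl setDv set0U. Qed.

Lemma deg_sumE U x : deg U x = \sum_y adj x y * (y \in U).
Proof.
rewrite /deg big_mkcond; apply: eq_bigr => y _.
by case: (y \in U); rewrite ?muln1 ?muln0.
Qed.

(** Dhar's burning criterion, for the graph induced on B in which each vertex x
    topples when its height reaches d x; the d x - deg B x particles that
    do not go to a neighbour in B fall into the sink. *)
Definition recurrent B d f : bool :=
  [forall x in B, f x < d x] &&
  [forall U : {set V}, (U \subset B) && (U != set0) ==>
     [exists x in U, deg U x <= f x]].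

Lemma recurrentP B d f :
  reflect ((forall x, x \in B -> f x < d x) /\
           (forall U, U \subset B -> U != set0 ->
              exists2 x, x \in U & deg U x <= f x))
          (recurrent B d f).
Proof.
apply: (iffP andP) => -[fd fU]; split.
- exact/forall_inP.
- move=> U sUB U0; have /implyP := forallP fU U.
  by rewrite sUB U0 => /(_ isT)/exists_inP.
- exact/forall_inP.
- apply/forallP => U; apply/implyP => /andP[sUB U0].
  exact/exists_inP/fU.
Qed.

Lemma eq_recurrent B d d' f f' : {in B, f =1 f'} -> {in B, d =1 d'} ->
  recurrent B d f = recurrent B d' f'.
Proof.
move=> ff dd; apply/recurrentP/recurrentP => -[fd fU]; split.
- by move=> x xB; rewrite -ff -?dd ?fd.
- move=> U sUB U0; have [x xU le] := fU U sUB U0; exists x => //.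
  by rewrite -ff ?(subsetP sUB).
- by move=> x xB; rewrite ff ?dd ?fd.
- move=> U sUB U0; have [x xU le] := fU U sUB U0; exists x => //.
  by rewrite ff ?(subsetP sUB).
Qed.

(** The trace left by a wave from z: in the configuration f obtained after the
    vertices of W have toppled once each, a vertex of W other than z has fewer
    particles than neighbours in W, whereas the complement of W can burn without
    the help of W.  The root z plays the part of a sink. *)
Definition is_imprint B z f W : Prop :=
  [/\ W \subset B, z \in W,
      forall x, x \in W -> x != z -> f x < deg W x &
      forall U, U \subset B :\: W -> U != set0 ->
        exists2 x, x \in U & deg (W :|: U) x <= f x].

(** A vertex of W outside W' would belong to a set that burns before W'
    according to the second configuration, but is blocked by W according to the
    first. *)
Lemma is_imprint_uniq B z f f' W W' : {in B :\ z, f =1 f'} ->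
  is_imprint B z f W -> is_imprint B z f' W' -> W = W'.
Proof.
suff main g g' U U' : {in B :\ z, g =1 g'} ->
    is_imprint B z g U -> is_imprint B z g' U' -> U \subset U'.
  move=> ff' i i'; apply/eqP; rewrite eqEsubset (main _ _ _ _ ff' i i').
  by rewrite (main _ _ _ _ _ i' i) // => x /ff' ->.
move=> gg' [sUB zU Ulow _] [sU'B zU' _ U'out].
rewrite -setD_eq0; apply: contraT => D0.
have [||x] := U'out (U :\: U'); [exact: setSD| exact: D0|].
rewrite inE => /andP[xU' xU].
have xz : x != z by apply: contraNneq xU' => ->.
have xB : x \in B :\ z by rewrite !inE xz (subsetP sUB).
rewrite leqNgt -gg' // (leq_trans (Ulow x xU xz)) //.
by apply: degS; rewrite setU_setD subsetUr.
Qed.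

(** A set of maximal size stands for the largest one: the sets in question are
    stable under union. *)
Definition imprint B z f : {set V} :=
  [arg max_(W > [set z] | (W \subset B) && (z \in W) &&
      [forall x in W, (x != z) ==> (f x < deg W x)]) #|W|].

Lemma imprintP B z f : z \in B -> is_imprint B z f (imprint B z f).
Proof.
move=> zB; rewrite /imprint; case: arg_maxnP => [|W].
  rewrite sub1set zB inE eqxx /=; apply/forall_inP => x.
  by rewrite inE => /eqP ->; rewrite eqxx.
case/andP=> /andP[sWB zW] /forall_inP Wlow Wmax; split=> //.
  by move=> x xW xz; have := Wlow x xW; rewrite xz.
move=> U sU U0; apply/exists_inP; apply: contraT => /exists_inPn Ulow.
have /set0Pn[u uU] := U0.
have : #|W :|: U| <= #|W|.
  apply: Wmax; apply/andP; split; first apply/andP; [split|].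
  - by rewrite subUset sWB (subset_trans sU) ?subsetDl.
  - by rewrite inE zW.
  apply/forall_inP => x; rewrite inE => /orP[xW|xU]; apply/implyP => xz.
    have /implyP/(_ xz) lt := Wlow x xW.
    exact: leq_trans lt (degS _ (subsetUl _ _)).
  by rewrite ltnNge; exact: Ulow.
have uW : u \notin W by have := subsetP sU u uU; rewrite inE => /andP[].
rewrite leqNgt => /negP[]; apply: proper_card; apply/properP.
by split; [exact: subsetUl | exists u; rewrite ?inE ?uU ?orbT].
Qed.

(** The set W of vertices that topple once z has been forced to topple once: the
    vertices outside W stay stable, and no part U of W can be left out. *)
Definition is_wave B d z f W : Prop :=
  [/\ W \subset B, z \in W,
      forall x, x \in B :\: W -> f x + deg W x < d x &
      forall U, U \subset W :\ z -> U != set0 ->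
        exists2 x, x \in U & d x <= f x + deg (W :\: U) x].

Definition wave B d z f : {set V} :=
  [arg min_(W < B | (W \subset B) && (z \in W) &&
      [forall x in B :\: W, f x + deg W x < d x]) #|W|].

Lemma waveP B d z f : z \in B -> is_wave B d z f (wave B d z f).
Proof.
move=> zB; rewrite /wave; case: arg_minnP => [|W].
  by rewrite subxx zB /=; apply/forall_inP => x; rewrite setDv inE.
case/andP=> /andP[sWB zW] /forall_inP Wout Wmin; split=> //.
move=> U sU U0; apply/exists_inP; apply: contraT => /exists_inPn Ulow.
have /set0Pn[u uU] := U0.
have sUW : U \subset W by apply: subset_trans sU (subsetDl _ _).
have zU : z \notin U by apply/negP => /(subsetP sU); rewrite !inE eqxx.
have : #|W| <= #|W :\: U|.
  apply: Wmin; apply/andP; split; first apply/andP; [split|].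
  - exact: subset_trans (subsetDl _ _) sWB.
  - by rewrite inE zW zU.
  apply/forall_inP => x; rewrite !inE => /andP[+ xB].
  case xU: (x \in U) => /= xW.
    by rewrite ltnNge; exact: Ulow.
  apply: leq_ltn_trans (Wout x _); last by rewrite inE xW.
  by rewrite leq_add2l degS ?subsetDl.
rewrite leqNgt => /negP[]; apply: proper_card; apply/properP.
by split; [exact: subsetDl | exists u; rewrite ?inE ?uU ?(subsetP sUW)].
Qed.

(** Toppling a wave keeps a configuration recurrent and leaves the toppled set as
    its imprint; so the wave can be read off, and undone, from the result. *)
Lemma imprint_wave B d z f g W : (forall x, x \in B -> deg B x <= d x) ->
  recurrent (B :\ z) d f -> is_wave B d z f W ->
  (forall x, x \in B :\ z -> g x = f x + deg W x - (x \in W) * d x) ->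
  [/\ recurrent (B :\ z) d g, is_imprint B z g W &
      forall x, x \in B :\ z -> g x + (x \in W) * d x = f x + deg W x].
Proof.
move=> dB /recurrentP[fd frec] [sWB zW Wout Win] gE.
have gin x : x \in W -> x != z -> g x = f x + deg W x - d x.
  by move=> xW xz; rewrite gE ?xW ?mul1n // !inE xz (subsetP sWB).
have gout x : x \in B -> x \notin W -> g x = f x + deg W x.
  move=> xB xW; rewrite gE ?(negPf xW) ?mul0n ?subn0 // !inE xB andbT.
  by apply: contraNneq xW => ->.
have dle x : x \in W -> x != z -> d x <= f x + deg W x.
  move=> xW xz; have [||y] := Win [set x].
  - by rewrite sub1set !inE xz.
  - by apply/set0Pn; exists x; rewrite inE.
  by rewrite inE => /eqP ->; rewrite degD1.
have fdW x : x \in W -> x != z -> f x < d x.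
  by move=> xW xz; rewrite fd // !inE xz (subsetP sWB).
have outB U x : U \subset B -> x \in U :\: W -> (x \in B) && (x \notin W).
  by move=> sUB; rewrite inE => /andP[-> xU]; rewrite (subsetP sUB).
(* The vertices outside W only gained particles, exactly one from each
   neighbour in W: they burn without W in g whenever they burn in f. *)
have recout U : U \subset B -> U :\: W != set0 ->
    exists2 x, x \in U :\: W & deg (W :|: U) x <= g x.
  move=> sUB U0; have [||x xU le] := frec (U :\: W) => //.
    apply/subsetP => x xUW; have /andP[xB xW] := outB U x sUB xUW.
    by rewrite !inE xB andbT; apply: contraNneq xW => ->.
  have /andP[xB xW] := outB U x sUB xU.
  exists x => //; rewrite gout // (leq_trans (deg_le_U _ _ _)) //.
  by rewrite addnC leq_add2r.
split.
- apply/recurrentP; split=> [x|U sU U0].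
    rewrite !inE => /andP[xz xB]; case xW: (x \in W).
      rewrite gin //; have := fdW x xW xz; have := dle x xW xz.
      by have := degS x sWB; have := dB x xB; lia.
    by rewrite gout ?xW // Wout // inE xB xW.
  have sUB : U \subset B by apply: subset_trans sU (subsetDl _ _).
  have [UW|UW] := eqVneq (U :\: W) set0; last first.
    have [x] := recout U sUB UW; rewrite inE => /andP[_ xU] le.
    by exists x => //; apply: leq_trans le; apply: degS (subsetUr _ _).
  have sUW : U \subset W by rewrite -setD_eq0 UW.
  have [|x xU le] := Win U _ U0.
    apply/subsetP => x xU; have := subsetP sU x xU.
    by rewrite !inE (subsetP sUW) // => /andP[->].
  exists x => //; have := subsetP sU x xU; rewrite !inE => /andP[xz xB].
  by rewrite gin ?(subsetP sUW) // (degDS x sUW); lia.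
- split=> // [x xW xz|U sU U0].
    rewrite gin //; have := fdW x xW xz; have := dle x xW xz; lia.
  have UD : U :\: W = U.
    apply/setDidPl; rewrite disjoint_sym -setI_eq0; apply/eqP/setP => x.
    rewrite !inE; apply/negP => /andP[xW /(subsetP sU)].
    by rewrite !inE xW.
  have [||x] := recout U; rewrite ?UD //.
    exact: subset_trans sU (subsetDl _ _).
  by exists x.
- move=> x; rewrite !inE => /andP[xz xB]; case xW: (x \in W).
    by rewrite gin // mul1n subnK ?dle.
  by rewrite gout ?xW // addn0.
Qed.

(** Which heights v at the former sink z make the configuration recurrent: the
    imprint is the set that remains unburnt as long as z does not burn, so z has
    to burn when all its neighbours in the imprint are still unburnt. *)
Lemma recurrent_root B d z f v : z \in B -> recurrent (B :\ z) d f ->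
  recurrent B d (fun x => if x == z then v else f x) =
  (deg (imprint B z f) z <= v < d z).
Proof.
move=> zB /recurrentP[fd frec].
have [sWB zW Wlow Wout] := imprintP f zB; set W := imprint B z f in sWB zW Wlow Wout *.
apply/recurrentP/andP => [[lt rec]|[le lt]].
  have := lt z zB; rewrite eqxx => ->; split=> //.
  have [|x xW] := rec W sWB; first by apply/set0Pn; exists z.
  by case: eqVneq => [->//|xz]; rewrite leqNgt Wlow.
split=> [x xB|U sUB U0]; first by case: eqVneq => [->//|xz]; rewrite fd // !inE xz.
have [UW|UW] := eqVneq (U :\: W) set0; last first.
  have [||x] := Wout (U :\: W) => //; first exact: setSD.
  rewrite inE => /andP[xW xU] lex; exists x => //.
  rewrite ifN; last by apply: contraNneq xW => ->.
  by apply: leq_trans lex; apply: degS; rewrite setU_setD subsetUr.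
have sUW : U \subset W by rewrite -setD_eq0 UW.
case zU: (z \in U); first by exists z; rewrite // eqxx (leq_trans (degS _ sUW)).
have [||x xU lex] := frec U => //.
  apply/subsetP => x xU; rewrite !inE (subsetP sUB) // andbT.
  by apply: contraFneq zU => <-.
by exists x => //; rewrite ifN //; apply: contraFneq zU => <-.
Qed.

(** * Counting the waves from one vertex *)

Section Count.
Variable n : nat.
Local Notation config := {ffun V -> 'I_n.+1}.
Implicit Types (g h : config).

Definition val_of g : V -> nat := fun x => g x.

(** Heights outside B are set to 0, so that each configuration on B is counted
    once. *)
Definition recurrent_configs B d : {set config} :=
  [set g | recurrent B d (val_of g) && [forall x, (x \notin B) ==> (g x == ord0)]].

Lemma recurrent_configsP B d g :
  reflect (recurrent B d (val_of g) /\ forall x, x \notin B -> g x = ord0)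
          (g \in recurrent_configs B d).
Proof.
rewrite inE; apply: (iffP andP) => -[gr g0]; split=> //.
  by move=> x xB; have /implyP/(_ xB)/eqP := forallP g0 x.
by apply/forallP => x; apply/implyP => /g0 ->.
Qed.

Definition topple_wave B d z g : config :=
  let W := wave B d z (val_of g) in
  [ffun x => inord (if x \in B :\ z then g x + deg W x - (x \in W) * d x else 0)].

(** The number of waves from z that topple y.  As a function of y it is a multiple
    of the Green function of B with pole z, provided that B has access to a
    sink: the Laplace equation is [wave_count_harmonic] off z and
    [wave_count_root] at z. *)
Definition wave_count B d z y : nat :=
  \sum_(g in recurrent_configs (B :\ z) d) (y \in imprint B z (val_of g)).

Section OneRoot.
Variables (B : {set V}) (d : V -> nat) (z : V).
Hypotheses (zB : z \in B) (dB : forall x, x \in B -> deg B x <= d x).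
Hypothesis dn : forall x, d x <= n.+1.

Lemma topple_waveP g (W := wave B d z (val_of g)) (h := topple_wave B d z g) :
  g \in recurrent_configs (B :\ z) d ->
  [/\ h \in recurrent_configs (B :\ z) d, imprint B z (val_of h) = W &
   forall x, x \in B :\ z -> h x + (x \in W) * d x = g x + deg W x].
Proof.
move=> /recurrent_configsP[gr g0].
have Ww := waveP d (val_of g) zB.
pose k x := g x + deg W x - (x \in W) * d x.
have [kr kW kE] := imprint_wave dB gr Ww (fun x _ => erefl (k x)).
have hk : {in B :\ z, val_of h =1 k}.
  move=> x xB; rewrite /val_of ffunE xB inordK //.
  have /recurrentP[kd _] := kr.
  exact: leq_trans (kd x xB) (dn x).
split.
- apply/recurrent_configsP; split; first by rewrite (eq_recurrent hk (fun x _ => erefl)).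
  by move=> x xB; rewrite ffunE (negPf xB); apply: val_inj; rewrite /= inordK.
- exact: is_imprint_uniq hk (imprintP _ zB) kW.
- by move=> x xB; rewrite -[h x : nat]/(val_of h x) hk //; exact: kE.
Qed.

Lemma topple_wave_inj : {in recurrent_configs (B :\ z) d &, injective (topple_wave B d z)}.
Proof.
move=> g g' gr gr' E.
have [_ W1 e1] := topple_waveP gr; have [_ W2 e2] := topple_waveP gr'.
rewrite -W1 E in e1; rewrite -W2 in e2.
apply/ffunP => x; apply: val_inj; case xB: (x \in B :\ z); last first.
  have /recurrent_configsP[_ ->] := gr; last by rewrite xB.
  by have /recurrent_configsP[_ ->] := gr'; last by rewrite xB.
have := e1 x xB; rewrite (e2 x xB) => /eqP; rewrite eqn_add2r => /eqP e.
exact: esym.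
Qed.

(** An injection of a finite set into itself is a permutation. *)
Lemma sum_topple_wave (F : config -> nat) :
  \sum_(g in recurrent_configs (B :\ z) d) F (topple_wave B d z g) =
  \sum_(g in recurrent_configs (B :\ z) d) F g.
Proof.
rewrite -(big_imset F topple_wave_inj) /=; apply: eq_bigl => h.
suff -> : topple_wave B d z @: recurrent_configs (B :\ z) d =
  recurrent_configs (B :\ z) d by [].
apply/eqP; rewrite eqEcard card_in_imset ?leqnn ?andbT //; last first.
  exact: topple_wave_inj.
by apply/subsetP => _ /imsetP[g gr ->]; have [] := topple_waveP gr.
Qed.

Lemma wave_count_sum_deg x :
  \sum_(g in recurrent_configs (B :\ z) d) deg (imprint B z (val_of g)) x =
  \sum_y adj x y * wave_count B d z y.
Proof.
under eq_bigr => g _ do rewrite deg_sumE.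
rewrite exchange_big; apply: eq_bigr => y _.
by rewrite /wave_count big_distrr.
Qed.

(** The total height at x is the same before and after the permutation that
    topples a wave in every configuration.  A wave W takes d x particles from x
    if it contains x, and brings deg W x of them. *)
Lemma wave_count_harmonic x : x \in B -> x != z ->
  d x * wave_count B d z x = \sum_y adj x y * wave_count B d z y.
Proof.
move=> xB xz; rewrite -wave_count_sum_deg /wave_count.
have xBz : x \in B :\ z by rewrite !inE xz.
apply/eqP; rewrite -(eqn_add2l (\sum_(g in recurrent_configs (B :\ z) d) g x)); apply/eqP.
rewrite -{1}(sum_topple_wave (fun g => g x : nat)) big_distrr /=.
rewrite -(sum_topple_wave (fun g => d x * _)) -(sum_topple_wave (fun g => deg _ _)).
rewrite -!big_split /=; apply: eq_bigr => g gr.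
have [_ -> e] := topple_waveP gr; rewrite mulnC; exact: e.
Qed.

Definition clear_root (h : config) : config :=
  [ffun x => if x == z then ord0 else h x].

(** The admissible heights at z are those given by [recurrent_root]. *)
Lemma card_extensions g : g \in recurrent_configs (B :\ z) d ->
  \sum_(h in recurrent_configs B d | clear_root h == g) 1 =
  d z - deg (imprint B z (val_of g)) z.
Proof.
move=> /recurrent_configsP[gr g0]; set a := deg _ z.
pose ext (v : 'I_n.+1) : config := [ffun x => if x == z then v else g x].
have extI : injective ext.
  by move=> v w /ffunP/(_ z); rewrite !ffunE eqxx.
have zBz : z \notin B :\ z by rewrite !inE eqxx.
have extr v : (ext v \in recurrent_configs B d) = (a <= v < d z).
  rewrite -(recurrent_root v zB gr) inE.
  rewrite (@eq_recurrent B d d _ (fun x => if x == z then v : nat else val_of g x)) //.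
    rewrite andbC; case: forallP => // -[] x; apply/implyP => xB.
    by rewrite ffunE ifN; [rewrite g0 // !inE (negPf xB) andbF|apply: contraNneq xB => ->].
  by move=> x xB; rewrite /val_of ffunE; case: ifP.
transitivity #|[set v : 'I_n.+1 | a <= v < d z]|.
  rewrite sum1_card -(card_imset _ extI); apply: eq_card => h.
  apply/idP/imsetP => [/andP[hr /eqP hg]|[v]].
    have hE : ext (h z) = h.
      by apply/ffunP => x; rewrite ffunE -hg ffunE; case: eqP => // ->.
    by exists (h z); rewrite ?hE // inE -extr hE.
  rewrite inE -extr => er ->; apply/andP; split=> //; apply/eqP/ffunP => x.
  by rewrite !ffunE; case: eqP => // ->; rewrite g0.
rewrite -sum1_card; under eq_bigl => v do rewrite inE.
rewrite -(big_ord_widen_cond _ (fun v => a <= v) (fun=> 1) (dn z)).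
transitivity (\sum_(a <= i < d z) 1); first by rewrite big_geq_mkord.
by rewrite sum_nat_const_nat muln1.
Qed.

(** Sorting the recurrent configurations on B by their restriction to B minus z
    counts them as the sum of d z - deg W z over the imprints W. *)
Lemma wave_count_root :
  d z * wave_count B d z z =
  #|recurrent_configs B d| + \sum_y adj z y * wave_count B d z y.
Proof.
have zBz : z \notin B :\ z by rewrite !inE eqxx.
rewrite -wave_count_sum_deg -sum1_card.
rewrite (partition_big clear_root (mem (recurrent_configs (B :\ z) d))) /=; last first.
  move=> h /recurrent_configsP[/recurrentP[hd hr] h0]; apply/recurrent_configsP; split; last first.
    move=> x; rewrite ffunE; case: eqP => // /eqP xz.
    by rewrite !inE xz /= => /h0.
  have E : {in B :\ z, val_of (clear_root h) =1 val_of h}.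
    by move=> x; rewrite !inE /val_of ffunE => /andP[/negPf ->].
  rewrite (eq_recurrent E (fun x _ => erefl)); apply/recurrentP; split.
    by move=> x; rewrite !inE => /andP[_ /hd].
  by move=> U sU; apply: hr; apply: subset_trans sU (subsetDl _ _).
under eq_bigr => g gr do rewrite card_extensions //.
rewrite -big_split /wave_count big_distrr /=; apply: eq_bigr => g gr.
have [sWB zW _ _] := imprintP (val_of g) zB.
by rewrite zW muln1 subnK // (leq_trans (degS _ sWB)) ?dB.
Qed.
End OneRoot.

(** * Changing the root of a wave *)

Section TwoRoots.
Hypothesis deg_n : forall U x, deg U x <= n.

Lemma wave_count_out B d z y : z \in B -> y \notin B -> wave_count B d z y = 0.
Proof.
move=> zB yB; rewrite /wave_count big1 // => g _.
have [sWB _ _ _] := imprintP (val_of g) zB.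
by rewrite (contraNF (subsetP sWB y)).
Qed.

(** The inverse of a symmetric matrix is symmetric.  The factor in front is kept
    because it may vanish: a graph without sink has no recurrent
    configuration. *)
Lemma wave_count_sym B d z u : z \in B -> u \in B ->
  (forall x, x \in B -> deg B x <= d x) -> (forall x, d x <= n.+1) ->
  #|recurrent_configs B d| * wave_count B d z u = #|recurrent_configs B d| * wave_count B d u z.
Proof.
move=> zB uB dB dn; set T := wave_count B d; set r := #|recurrent_configs B d|.
pose D a b := \sum_x T a x * (d x * T b x).
pose S a b := \sum_x \sum_y T a x * (adj x y * T b y).
have DC a b : D a b = D b a by apply: eq_bigr => x _; rewrite mulnCA [RHS]mulnCA (mulnC (T a x)).
have SC a b : S a b = S b a.
  rewrite /S exchange_big; apply: eq_bigr => x _; apply: eq_bigr => y _.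
  by rewrite adj_sym mulnCA [RHS]mulnCA (mulnC (T a y)).
have main a b : a \in B -> b \in B -> D a b = r * T a b + S a b.
  move=> aB bB; rewrite /D (bigD1 b) //= /S [in RHS](bigD1 b) //=.
  rewrite (wave_count_root bB dB dn) mulnDr (mulnC (T a b) #|_|) -!addnA.
  congr (_ + (_ + _)); first by rewrite big_distrr.
  apply: eq_bigr => x xb.
  have [xB|xB] := boolP (x \in B).
    by rewrite wave_count_harmonic // big_distrr.
  by rewrite /T (wave_count_out _ aB xB) mul0n big1 // => y _; rewrite mul0n.
have := main u z uB zB; rewrite DC SC main // => /eqP.
by rewrite eqn_add2r => /eqP.
Qed.

(** The sandpile form of the equality of the principal cofactors of a graph
    Laplacian.  Give W a sink attached to a vertex o only.  A wave from z that
    reaches o has to topple all of W, since a proper subset would leave behind a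
    set that has no access to the sink.  So the waves from z through o are the
    recurrent configurations of W with sink z, and the symmetry of [wave_count]
    compares z with o. *)
Lemma recurrent_configs_card_root W a b : a \in W -> b \in W ->
  #|recurrent_configs (W :\ a) (deg W)| = #|recurrent_configs (W :\ b) (deg W)|.
Proof.
have imW z g : z \in W -> g \in recurrent_configs (W :\ z) (deg W) ->
    imprint W z (val_of g) = W.
  move=> zW /recurrent_configsP[/recurrentP[gd _] _].
  apply: (is_imprint_uniq (fun _ _ => erefl) (imprintP _ zW)).
  split=> // [x xW xz|U]; first by rewrite gd // !inE xz.
  by rewrite setDv subset0 => /eqP-> /eqP.
pose d o x := deg W x + (x == o).
have step o z : o \in W -> z \in W ->
    wave_count W (d o) z o = #|recurrent_configs (W :\ z) (deg W)|.
  move=> oW zW; rewrite /wave_count.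
  transitivity (\sum_(g in recurrent_configs (W :\ z) (d o) |
      o \in imprint W z (val_of g)) 1).
    by rewrite big_mkcondr; apply: eq_bigr => g _; case: (o \in _).
  rewrite sum1_card; apply: eq_card => g; apply/andP/idP => [[]|].
    move=> /recurrent_configsP[/recurrentP[gd gr] g0] oI; apply/recurrent_configsP; split=> //.
    apply/recurrentP; split=> // x; rewrite !inE => /andP[xz xW].
    have [sIW zI Ilow Iout] := imprintP (val_of g) zW.
    suff IW : imprint W z (val_of g) = W by have := Ilow x; rewrite IW; apply.
    apply/eqP; rewrite eqEsubset sIW -setD_eq0; apply: contraT => U0.
    have [//|y yU] := Iout _ _ U0.
    rewrite setU_setD (setUidPr sIW) leqNgt => /negP[].
    move: yU; rewrite inE => /andP[yI yW].
    have yo : y != o by apply: contraNneq yI => ->.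
    have yz : y != z by apply: contraNneq yI => ->.
    by have := gd y; rewrite !inE yz yW /d (negPf yo) addn0; apply.
  move=> gr; split; last by rewrite imW.
  have /recurrent_configsP[/recurrentP[gd grec] g0] := gr; apply/recurrent_configsP; split=> //.
  apply/recurrentP; split=> // x /gd gx; exact: leq_trans gx (leq_addr _ _).
(* The recurrent configurations of W with its sink at o are as many as those
   of W minus o, which makes the factor of [wave_count_sym] explicit. *)
have key o e : o \in W -> e \in W ->
    #|recurrent_configs (W :\ o) (deg W)| * #|recurrent_configs (W :\ o) (deg W)| =
    #|recurrent_configs (W :\ o) (deg W)| * #|recurrent_configs (W :\ e) (deg W)|.
  move=> oW eW.
  have dB x : x \in W -> deg W x <= d o x by move=> _; apply: leq_addr.
  have dn x : d o x <= n.+1.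
    by rewrite /d -addn1; apply: leq_add (deg_n _ _) _; case: eqP.
  have T1 y : y \in W -> wave_count W (d o) o y = #|recurrent_configs (W :\ o) (deg W)|.
    move=> yW; rewrite -(step o) // /wave_count; apply: eq_bigr => g gr.
    have gr' : g \in recurrent_configs (W :\ o) (deg W).
      move: gr => /recurrent_configsP[gr g0]; apply/recurrent_configsP; split=> //.
      rewrite -(eq_recurrent (fun _ _ => erefl) (d := d o)) // => x.
      by rewrite !inE /d => /andP[/negPf-> _]; rewrite addn0.
    by rewrite imW // yW oW.
  have r1 : #|recurrent_configs W (d o)| = #|recurrent_configs (W :\ o) (deg W)|.
    have := wave_count_root oW dB dn; rewrite T1 // {1}/d eqxx mulnDl mul1n.
    have -> : \sum_y adj o y * wave_count W (d o) o y =
              deg W o * #|recurrent_configs (W :\ o) (deg W)|.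
      rewrite deg_sumE big_distrl; apply: eq_bigr => y _ /=.
      have [yW|yW] := boolP (y \in W); first by rewrite T1 // muln1.
      by rewrite wave_count_out // !muln0.
    by rewrite addnC => /eqP; rewrite eqn_add2r => /eqP.
  by have := wave_count_sym oW eW dB dn; rewrite r1 T1 // step.
(* From p * p = p * q and q * q = q * p, even if p or q is 0. *)
move=> aW bW; have := key a b aW bW; have := key b a bW aW.
move=> /eqP; rewrite eqn_mul2l => /orP[/eqP b0|/eqP->//].
by move=> /eqP; rewrite eqn_mul2l => /orP[/eqP a0|/eqP//]; rewrite a0 b0.
Qed.

(** What a wave W leaves on the complement of W. *)
Definition outer_configs B d W : {set config} :=
  [set q : config | [forall x in B :\: W, q x < d x] &&
     [forall U : {set V}, (U \subset B :\: W) && (U != set0) ==>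
        [exists x in U, deg (W :|: U) x <= q x]] &&
     [forall x, (x \notin B :\: W) ==> (q x == ord0)]].

Lemma outer_configsP B d W (q : config) :
  reflect [/\ forall x, x \in B :\: W -> q x < d x,
      forall U, U \subset B :\: W -> U != set0 ->
        exists2 x, x \in U & deg (W :|: U) x <= q x &
      forall x, x \notin B :\: W -> q x = ord0]
    (q \in outer_configs B d W).
Proof.
rewrite inE; apply: (iffP andP) => [[/andP[qd qU] q0]|[qd qU q0]]; split.
- exact/forall_inP.
- move=> U sU U0; have /implyP := forallP qU U.
  by rewrite sU U0 => /(_ isT)/exists_inP.
- by move=> x xB; have /implyP/(_ xB)/eqP := forallP q0 x.
- apply/andP; split; first exact/forall_inP.
  apply/forallP => U; apply/implyP => /andP[sU U0].
  exact/exists_inP/qU.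
- by apply/forallP => x; apply/implyP => /q0 ->.
Qed.

Definition restrict (U : {set V}) (g : config) : config :=
  [ffun x => if x \in U then g x else ord0].

(** Inside and outside of an imprint the configuration can be chosen
    independently, and only the inside depends on the root z. *)
Lemma card_imprint_class B d z W :
  z \in W -> W \subset B -> (forall x, x \in B -> deg B x <= d x) ->
  #|[set g in recurrent_configs (B :\ z) d | imprint B z (val_of g) == W]| =
  #|recurrent_configs (W :\ z) (deg W)| * #|outer_configs B d W|.
Proof.
move=> zW sWB dB; have zB := subsetP sWB z zW.
pose split_at (g : config) := (restrict (W :\ z) g, restrict (B :\: W) g).
rewrite -cardsX -(@card_in_imset _ _ split_at); last first.
  move=> g g'; rewrite !inE => /andP[/andP[_ g0] _] /andP[/andP[_ g0'] _].
  move=> [/ffunP e1 /ffunP e2]; apply/ffunP => x.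
  have := e1 x; have := e2 x; rewrite !ffunE !inE.
  case xB: (x \in B :\ z); last first.
    have /implyP := forallP g0 x; have /implyP := forallP g0' x.
    by rewrite xB => /(_ isT)/eqP-> /(_ isT)/eqP->.
  by move: xB; rewrite !inE => /andP[-> ->]; case: (x \in W).
apply: eq_card => -[p q]; rewrite [in RHS]inE /=.
apply/imsetP/andP => [[g]|[/recurrent_configsP[/recurrentP[pd pr] p0] /outer_configsP[qd qr q0]]].
  rewrite inE => /andP[/recurrent_configsP[/recurrentP[gd gr] g0] /eqP gW] [-> ->].
  have [_ _ low out] := imprintP (val_of g) zB; rewrite gW in low out.
  split.
    apply/recurrent_configsP; split; last by move=> x xW; rewrite ffunE (negPf xW).
    have E : {in W :\ z, val_of (restrict (W :\ z) g) =1 val_of g}.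
      by move=> x xW; rewrite /val_of ffunE xW.
    rewrite (eq_recurrent E (fun _ _ => erefl)); apply/recurrentP; split.
      by move=> x; rewrite !inE => /andP[xz xW]; apply: low.
    by move=> U sU; apply: gr; apply: subset_trans sU (setSD _ sWB).
  apply/outer_configsP; split.
  - move=> x xB; rewrite ffunE xB; apply: gd.
    move: xB; rewrite !inE => /andP[xW ->]; rewrite andbT.
    by apply: contraNneq xW => ->.
  - move=> U sU U0; have [x xU le] := out U sU U0; exists x => //.
    by rewrite ffunE (subsetP sU).
  - by move=> x xB; rewrite ffunE (negPf xB).
pose g : config := [ffun x => if x \in W then p x else q x].
have gp x : x \in W -> g x = p x by move=> xW; rewrite ffunE xW.
have gq x : x \notin W -> g x = q x by move=> xW; rewrite ffunE (negPf xW).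
have gW : is_imprint B z (val_of g) W.
  split=> //.
    by move=> x xW xz; rewrite /val_of gp // pd // !inE xz.
  move=> U sU U0; have [x xU le] := qr U sU U0; exists x => //.
  by rewrite /val_of gq //; have := subsetP sU x xU; rewrite inE => /andP[].
exists g; last first.
  congr (_, _); apply/ffunP => x; rewrite !ffunE; case: ifP.
  - by rewrite inE => /andP[_ ->].
  - by move=> xW; rewrite p0 ?xW.
  - by rewrite inE => /andP[/negPf->].
  - by move=> xW; rewrite q0 ?xW.
rewrite inE; apply/andP; split; last first.
  by apply/eqP; apply: is_imprint_uniq (imprintP _ zB) gW.
apply/recurrent_configsP; split.
  apply/recurrentP; split=> [x|U sU U0].
    rewrite !inE => /andP[xz xB]; case xW: (x \in W).
      rewrite /val_of gp // (leq_trans (pd x _)) ?inE ?xz ?xW //.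
      by rewrite (leq_trans (degS _ sWB)) ?dB.
    by rewrite /val_of gq ?xW // qd // inE xW.
  have sUB : U \subset B by apply: subset_trans sU (subsetDl _ _).
  have [UW|UW] := eqVneq (U :\: W) set0; last first.
    have [||x xU le] := qr (U :\: W) => //; first exact: setSD.
    move: xU; rewrite inE => /andP[xW xU]; exists x => //.
    rewrite /val_of gq //; apply: leq_trans le; apply: degS.
    by rewrite setU_setD subsetUr.
  have sUW : U \subset W by rewrite -setD_eq0 UW.
  have [||x xU le] := pr U => //.
    apply/subsetP => x xU; have := subsetP sU x xU.
    by rewrite !inE (subsetP sUW) // => /andP[->].
  by exists x => //; rewrite /val_of gp ?(subsetP sUW).
move=> x; rewrite !inE negb_and negbK => /orP[/eqP->|xB].
  by rewrite gp // p0 // !inE eqxx.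
have xW : x \notin W by apply: contra xB => /(subsetP sWB).
by rewrite gq // q0 // !inE (negPf xB) andbF.
Qed.

Lemma card_imprint_mem B d a b (P : pred {set V}) : a \in B -> b \in B ->
  (forall x, x \in B -> deg B x <= d x) ->
  #|[set g in recurrent_configs (B :\ a) d | P (imprint B a (val_of g)) &&
       (b \in imprint B a (val_of g))]| =
  #|[set g in recurrent_configs (B :\ b) d | P (imprint B b (val_of g)) &&
       (a \in imprint B b (val_of g))]|.
Proof.
have main z u : z \in B -> (forall x, x \in B -> deg B x <= d x) ->
    #|[set g in recurrent_configs (B :\ z) d | P (imprint B z (val_of g)) &&
       (u \in imprint B z (val_of g))]| =
    \sum_(W : {set V} | [&& P W, z \in W, u \in W & W \subset B])
       #|recurrent_configs (W :\ z) (deg W)| * #|outer_configs B d W|.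
  move=> zB dB; rewrite -sum1_card.
  rewrite (partition_big (fun g => imprint B z (val_of g))
    (fun W => [&& P W, z \in W, u \in W & W \subset B])) /=; last first.
    move=> g; rewrite inE => /and3P[_ -> ->].
    by have [-> -> _ _] := imprintP (val_of g) zB.
  apply: eq_bigr => W /and4P[PW zW uW sWB].
  rewrite -card_imprint_class // -sum1_card; apply: eq_bigl => g.
  by rewrite !inE; case: eqP => [->|]; rewrite ?PW ?uW ?andbT ?andbF.
move=> aB bB dB; rewrite !main //; under eq_bigl => W do rewrite [X in _ && X]andbCA.
by apply: eq_bigr => W /and4P[_ bW aW _]; rewrite (recurrent_configs_card_root aW bW).
Qed.

(** Waves from o that contain e are as many as waves from e that contain o, also
    if they are asked to contain y. *)
Lemma wave_count_le B d o e y : o \in B -> e \in B ->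
  (forall x, x \in B -> deg B x <= d x) ->
  wave_count B d o y <= wave_count B d e y +
    #|[set g in recurrent_configs (B :\ o) d | (y \in imprint B o (val_of g)) &&
        (e \notin imprint B o (val_of g))]|.
Proof.
move=> oB eB dB.
have wcE z : wave_count B d z y =
    #|[set g in recurrent_configs (B :\ z) d | y \in imprint B z (val_of g)]|.
  rewrite /wave_count -sum1_card big_mkcond [RHS]big_mkcond /=.
  by apply: eq_bigr => g _; rewrite [in RHS]inE; case: (g \in _) => //; case: (y \in _).
rewrite !wcE -(cardsID [set g | e \in imprint B o (val_of g)]).
apply: leq_add.
  have := card_imprint_mem (fun W => y \in W) oB eB dB.
  move=> eq; rewrite (_ : #|_ :&: _| = #|[set g in recurrent_configs (B :\ o) d | (y \in imprint B o (val_of g)) &&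
       (e \in imprint B o (val_of g))]|); last first.
    by apply: eq_card => g; rewrite !inE -!andbA.
  rewrite eq; apply: subset_leq_card; apply/subsetP => g.
  by rewrite !inE => /andP[-> /andP[->]].
apply: eq_leq; apply: eq_card => g; rewrite !inE.
by case: (e \in _); rewrite ?andbF ?andbT.
Qed.
End TwoRoots.
End Count.
End Graph.

(** * A test function in one variable *)

Section Bump.
Local Open Scope ring_scope.

(** On scale m both bumps vanish to second order at the ends of their support, so
    that truncating them leaves the second differences small: of order m for the
    first, which has slope m^2 at 0, and of order m^2 for the second, which is
    m^4 at 0. *)
Definition bump_odd (m s : int) : int :=
  if `|s| <= m then s * (m - `|s|) ^+ 2 else 0.
Definition bump_even (m t : int) : int :=
  if `|t| <= m then (m ^+ 2 - t ^+ 2) ^+ 2 else 0.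
Definition second_diff (f : int -> int) (s : int) : int :=
  2 * f s - f (s + 1) - f (s - 1).

Lemma bump_oddN m s : bump_odd m (- s) = - bump_odd m s.
Proof. by rewrite /bump_odd normrN; case: ifP => _; rewrite ?mulNr ?oppr0. Qed.

Lemma bump_odd0 m : bump_odd m 0 = 0.
Proof. by rewrite /bump_odd mul0r if_same. Qed.

Lemma bump_evenN m s : bump_even m (- s) = bump_even m s.
Proof. by rewrite /bump_even normrN sqrrN. Qed.

Lemma bump_odd_out m s : m <= `|s| -> bump_odd m s = 0.
Proof.
move=> h; rewrite /bump_odd; case: ifP => // h'.
have -> : `|s| = m by lia.
by rewrite subrr expr0n mulr0.
Qed.

Lemma bump_even_out m s : m <= `|s| -> bump_even m s = 0.
Proof.
move=> h; rewrite /bump_even; case: ifP => // h'.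
rewrite -[s ^+ 2]real_normK ?num_real //; have -> : `|s| = m by lia.
by rewrite subrr expr0n.
Qed.

Lemma bump_oddE m s : 0 <= s -> s <= m -> bump_odd m s = s * (m - s) ^+ 2.
Proof. by move=> s0 sm; rewrite /bump_odd ger0_norm // sm. Qed.

Lemma bump_evenE m s : `|s| <= m -> bump_even m s = (m ^+ 2 - s ^+ 2) ^+ 2.
Proof. by rewrite /bump_even => ->. Qed.

Lemma second_diff_out (f : int -> int) m s : (forall t, m <= `|t| -> f t = 0) ->
  m < `|s| -> second_diff f s = 0.
Proof. by move=> f0 h; rewrite /second_diff !f0 ?mulr0 ?subrr //; lia. Qed.

Lemma second_diff_odd0 m : second_diff (bump_odd m) 0 = 0.
Proof.
rewrite /second_diff add0r sub0r bump_oddN opprK.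
by rewrite bump_odd0 mulr0; ring.
Qed.

Lemma second_diffN (f : int -> int) s (c : int) : (forall t, f (- t) = c * f t) ->
  second_diff f (- s) = c * second_diff f s.
Proof.
move=> fN; rewrite /second_diff.
have -> : - s - 1 = - (s + 1) by ring.
have -> : - s + 1 = - (s - 1) by ring.
by rewrite !fN; ring.
Qed.

Lemma second_diff_odd_le m s : 0 <= m -> `|second_diff (bump_odd m) s| <= 4 * m.
Proof.
move=> m0; wlog s0 : s / 0 <= s => [th|].
  have [|sneg] := leP 0 s; first exact: th.
  rewrite -(opprK s) (@second_diffN _ _ (-1)) => [|t]; last first.
    by rewrite bump_oddN mulN1r.
  by rewrite mulN1r normrN; apply: th; lia.
have [sm|ms] := ltP m s.
  rewrite (@second_diff_out _ m) ?normr0; first lia.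
    exact: bump_odd_out.
  by lia.
have [->|sne] := eqVneq s 0; first by rewrite second_diff_odd0 normr0; lia.
rewrite /second_diff (@bump_oddE m s) // (@bump_oddE m (s - 1)); try lia.
have [->|smne] := eqVneq s m.
  rewrite bump_odd_out; last lia.
  have -> : 2 * (m * (m - m) ^+ 2) - 0 - (m - 1) * (m - (m - 1)) ^+ 2 = 1 - m by ring.
  lia.
rewrite bump_oddE; [|lia|lia].
have -> : 2 * (s * (m - s) ^+ 2) - (s + 1) * (m - (s + 1)) ^+ 2 -
   (s - 1) * (m - (s - 1)) ^+ 2 = 4 * m - 6 * s by ring.
lia.
Qed.

Lemma second_diff_even_le m s : 0 <= m ->
  `|second_diff (bump_even m) s| <= 8 * m ^+ 2 + 2.
Proof.
move=> m0; wlog s0 : s / 0 <= s => [th|].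
  have [|sneg] := leP 0 s; first exact: th.
  rewrite -(opprK s) (@second_diffN _ _ 1) => [|t]; last first.
    by rewrite bump_evenN mul1r.
  by rewrite mul1r; apply: th; lia.
have m2 : 0 <= m ^+ 2 by rewrite sqr_ge0.
have [sm|ms] := ltP m s.
  rewrite (@second_diff_out _ m) ?normr0; first lia.
    exact: bump_even_out.
  by lia.
have sm2 : s ^+ 2 <= m ^+ 2 by rewrite lerXn2r ?nnegrE.
have s2 : 0 <= s ^+ 2 by rewrite sqr_ge0.
have [->|smne] := eqVneq s m.
  have e0 : bump_even m m = 0 by apply: bump_even_out; lia.
  have e1 : bump_even m (m + 1) = 0 by apply: bump_even_out; lia.
  rewrite /second_diff e0 e1.
  have [m1|m1] := leP 1 m; last by rewrite bump_even_out; lia.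
  rewrite bump_evenE; last lia.
  have -> : 2 * 0 - 0 - (m ^+ 2 - (m - 1) ^+ 2) ^+ 2 = - (4 * m ^+ 2 - 4 * m + 1) by ring.
  have : m <= m ^+ 2 by rewrite expr2 ler_peMr.
  by move: m2; move: (m ^+ 2) => a; lia.
have sm' : s < m by lia.
rewrite /second_diff !bump_evenE; [|lia|lia|lia].
have -> : 2 * (m ^+ 2 - s ^+ 2) ^+ 2 - (m ^+ 2 - (s + 1) ^+ 2) ^+ 2 -
   (m ^+ 2 - (s - 1) ^+ 2) ^+ 2 = 4 * m ^+ 2 - 12 * s ^+ 2 - 2 by ring.
by move: m2 sm2 s2; move: (m ^+ 2) (s ^+ 2) => a b; lia.
Qed.

Lemma bump_odd_le m s : 0 <= m -> `|bump_odd m s| <= m ^+ 3.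
Proof.
move=> m0; rewrite /bump_odd; case: ifP => h; last by rewrite normr0 exprn_ge0.
rewrite normrM normrX (exprS m 2); apply: ler_pM => //.
by rewrite lerXn2r ?nnegrE //; lia.
Qed.

Lemma bump_even_le m s : 0 <= m -> `|bump_even m s| <= m ^+ 4.
Proof.
move=> m0; rewrite /bump_even; case: ifP => h; last by rewrite normr0 exprn_ge0.
rewrite normrX -[4%N]/(2 * 2)%N exprM lerXn2r ?nnegrE ?exprn_ge0 //.
have : s ^+ 2 <= m ^+ 2 by rewrite -[s ^+ 2]real_normK ?num_real // lerXn2r ?nnegrE.
have := sqr_ge0 s; move: (s ^+ 2) (m ^+ 2) => a b; lia.
Qed.
End Bump.

(** * The Laplacian of the box *)

Section Box.
Variable L : nat.
Implicit Types (x y z : box L) (U W : {set box L}).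

Lemma neighbour_sym : symmetric (@neighbour L).
Proof. by move=> x y; rewrite /neighbour distrC (distrC (coord2 x)). Qed.

Lemma neighbour_irr : irreflexive (@neighbour L).
Proof. by move=> x; rewrite /neighbour !subrr. Qed.

Lemma coord_bound x : (`|coord1 x| <= L%:Z)%R /\ (`|coord2 x| <= L%:Z)%R.
Proof.
rewrite /coord1 /coord2; case: x => -[i hi] [j hj] /=.
by rewrite -addnn in hi hj; split; lia.
Qed.

Lemma box_of_coord (u v : int) : (`|u| <= L%:Z)%R -> (`|v| <= L%:Z)%R ->
  exists x, coord1 x = u /\ coord2 x = v.
Proof.
move=> hu hv.
have hi w : (`|w| <= L%:Z)%R -> (absz (w + L%:Z)%R < (L.*2).+1)%N.
  by move=> hw; rewrite -addnn; lia.
exists (Ordinal (hi u hu), Ordinal (hi v hv)).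
by rewrite /coord1 /coord2 /=; split; lia.
Qed.

Lemma coord_inj x y : coord1 x = coord1 y -> coord2 x = coord2 y -> x = y.
Proof.
case: x y => [i j] [i' j']; rewrite /coord1 /coord2 /= => e1 e2.
by congr (_, _); apply: val_inj => /=; lia.
Qed.

Local Open Scope ring_scope.

Lemma sum_at (F : int -> int -> int) (u v : int) :
  `|u| <= L%:Z + 1 -> `|v| <= L%:Z + 1 ->
  (`|u| = L%:Z + 1 \/ `|v| = L%:Z + 1 -> F u v = 0) ->
  \sum_(y : box L) ((coord1 y == u) && (coord2 y == v))%:Z * F (coord1 y) (coord2 y)
    = F u v.
Proof.
move=> hu hv F0.
have [/andP[ui vi]|out] := boolP ((`|u| <= L%:Z) && (`|v| <= L%:Z)).
  have [x [xu xv]] := box_of_coord ui vi.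
  rewrite (bigD1 x) //= xu xv !eqxx mul1r big1 ?addr0 // => y yx.
  case: andP => [[/eqP yu /eqP yv]|]; last by rewrite mul0r.
  by case/eqP: yx; apply: coord_inj; rewrite ?xu ?xv.
rewrite big1 ?F0 //.
  by move: out; rewrite negb_and => /orP[] ?; [left|right]; lia.
move=> y _; case: andP => [[/eqP yu /eqP yv]|]; last by rewrite mul0r.
by have [] := coord_bound y; rewrite yu yv => a b; rewrite a b in out.
Qed.

(** A neighbour outside the box contributes nothing to the left-hand side, which
    is why F has to vanish on the layer around the box. *)
Lemma sum_neighbours (F : int -> int -> int) x (u := coord1 x) (v := coord2 x) :
  (forall s t, `|s| = L%:Z + 1 \/ `|t| = L%:Z + 1 -> F s t = 0) ->
  \sum_y (neighbour x y)%:Z * F (coord1 y) (coord2 y) =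
  F (u + 1) v + F (u - 1) v + F u (v + 1) + F u (v - 1).
Proof.
move=> F0; have [hu hv] := coord_bound x; rewrite -/u -/v in hu hv.
have su (s t : int) : `|s| <= L%:Z + 1 -> `|t| <= L%:Z + 1 ->
    \sum_(y : box L) ((coord1 y == s) && (coord2 y == t))%:Z * F (coord1 y) (coord2 y) = F s t.
  by move=> hs ht; apply: sum_at => //; apply: F0.
rewrite -(su (u + 1) v) -?(su (u - 1) v) -?(su u (v + 1)) -?(su u (v - 1)); try lia.
rewrite -!big_split; apply: eq_bigr => y _ /=; rewrite -!mulrDl; congr (_ * _).
rewrite /neighbour -/u -/v; move: (coord1 y) (coord2 y) => s t.
do 9? case: eqP => //=; lia.
Qed.

Definition in_box (s t : int) : int :=
  ((`|s| <= L%:Z) && (`|t| <= L%:Z))%:Z.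

Lemma deg_neighbours x (u := coord1 x) (v := coord2 x) :
  (deg (@neighbour L) setT x)%:Z =
  in_box (u + 1) v + in_box (u - 1) v + in_box u (v + 1) + in_box u (v - 1).
Proof.
rewrite -sum_neighbours; last first.
  by move=> s t; rewrite /in_box => -[] ->; case: andP => // -[]; lia.
rewrite deg_sumE (big_morph _ PoszD (erefl _)); apply: eq_bigr => y _.
have [a b] := coord_bound y; rewrite /in_box a b inE.
by rewrite mulr1 muln1.
Qed.

Lemma deg_le4 x U : (deg (@neighbour L) U x <= 4)%N.
Proof.
apply: leq_trans (degS _ _ (subsetT U)) _; have := deg_neighbours x.
rewrite /in_box; do 4! case: (_ && _) => //=; lia.
Qed.

Lemma deg_origin : (0 < L)%N -> deg (@neighbour L) setT (origin L) = 4%N.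
Proof.
move=> L0; have := deg_neighbours (origin L).
have [-> ->] := coord_origin L; rewrite /in_box.
lia.
Qed.

Local Close Scope ring_scope.

(** * Toppling: the abelian property *)

Local Notation nbr := (@neighbour L).

Lemma toppleE (eta : sandpile L) x y : 4 <= eta x ->
  topple x eta y + 4 * (y == x) = eta y + nbr y x.
Proof.
move=> le4; rewrite ffunE; case: eqP => [->|_].
  by rewrite neighbour_irr muln1 subnK ?addn0.
by rewrite muln0 addn0 neighbour_sym.
Qed.

Lemma topple_seqE s (eta : sandpile L) y : legal eta s ->
  topple_seq eta s y + 4 * count_mem y s =
  eta y + \sum_z nbr y z * count_mem z s.
Proof.
elim: s eta => [|x s IH] eta /=.
  by rewrite muln0 big1 // => z _; rewrite muln0.
move=> /andP[le4 /IH E]; have T := toppleE y le4.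
have -> : \sum_z nbr y z * ((x == z) + count_mem z s) =
          nbr y x + \sum_z nbr y z * count_mem z s.
  rewrite (eq_bigr _ (fun z _ => mulnDr _ _ _)) big_split /=; congr (_ + _).
  rewrite (bigD1 x) //= eqxx muln1 big1 ?addn0 // => z /negPf zx.
  by rewrite eq_sym zx muln0.
by rewrite mulnDr addnCA E (eq_sym x y) addnA (addnC (4 * _)) T addnA.
Qed.

Lemma legal_rcons (eta : sandpile L) s x :
  legal eta (rcons s x) = legal eta s && (4 <= topple_seq eta s x).
Proof. by elim: s eta => [|y s IH] eta /=; rewrite ?andbT // IH andbA. Qed.

(** At the first moment when s would topple a vertex y more often than t does, y
    has not received more particles than t sends to it, so that y is no more
    unstable than at the end of t. *)
Lemma least_action (eta : sandpile L) s t x :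
  legal eta s -> stabilizing eta t -> count_mem x s <= count_mem x t.
Proof.
move=> ls /andP[lt /forallP st].
elim/last_ind: s x ls => [//|s y IH] x.
rewrite legal_rcons => /andP[ls le4].
rewrite -cats1 count_cat /= addn0; case: (eqVneq y x) => [<-|_]; last first.
  by rewrite addn0; apply: IH.
rewrite addn1 ltnNge; apply/negP => ge.
have := topple_seqE y ls; have := topple_seqE y lt; have := st y.
have : \sum_z nbr y z * count_mem z s <= \sum_z nbr y z * count_mem z t.
  by apply: leq_sum => z _; rewrite leq_mul2l IH ?orbT.
have := IH y ls; move: (topple_seq eta s y) (topple_seq eta t y) (eta y) le4.
by move=> /= a b c; lia.
Qed.

Lemma stabilizing_count (eta : sandpile L) s t x :
  stabilizing eta s -> stabilizing eta t -> count_mem x s = count_mem x t.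
Proof.
move=> hs ht; have /andP[ls _] := hs; have /andP[lt _] := ht.
by apply/eqP; rewrite eqn_leq (least_action x ls ht) (least_action x lt hs).
Qed.

Lemma stabilizing_uniq (eta : sandpile L) s t :
  stabilizing eta s -> stabilizing eta t -> topple_seq eta s = topple_seq eta t.
Proof.
move=> hs ht; apply/ffunP => x.
have /andP[ls _] := hs; have /andP[lt _] := ht.
have := topple_seqE x ls; have := topple_seqE x lt.
under eq_bigr => z _ do rewrite (stabilizing_count z ht hs).
by rewrite (stabilizing_count x ht hs) => <- /eqP; rewrite eqn_add2r => /eqP.
Qed.

(** Such a weight makes every toppling lose mass, which forces avalanches to end;
    it also shows that every set of vertices has one with at most three
    neighbours in the set. *)
Lemma superharmonic_exists :
  exists h : box L -> nat, forall x, \sum_z nbr x z * h z < 4 * h x.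
Proof.
(* A product of concave functions that vanish on the layer around the box. *)
pose f (s : int) : int := ((L%:Z + 1) ^+ 2 - s ^+ 2)%R.
pose F s t : int := (f s * f t)%R.
have f0 s : (`|s| <= L%:Z -> 0 < f s)%R.
  by move=> hs; rewrite /f subr_gt0 -[(s ^+ 2)%R]real_normK ?num_real // ltrXn2r //; lia.
have Fpos x : (0 < F (coord1 x) (coord2 x))%R.
  by have [a b] := coord_bound x; rewrite mulr_gt0 ?f0.
exists (fun x => absz (F (coord1 x) (coord2 x))) => x.
rewrite -ltz_nat (big_morph _ PoszD (erefl _)).
under eq_bigr => z _ do rewrite PoszM gez0_abs ?ltW //.
rewrite (@sum_neighbours F); last first.
  have fb s : (`|s| = L%:Z + 1 -> f s = 0)%R.
    by move=> hs; rewrite /f -[(s ^+ 2)%R]real_normK ?num_real // hs subrr.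
  by move=> s t [] /fb e; rewrite /F e ?mul0r ?mulr0.
rewrite PoszM gez0_abs ?ltW //.
have [/f0 a /f0 b] := coord_bound x; rewrite /F; move: a b.
move: (coord1 x) (coord2 x) => u v a b; rewrite -subr_gt0.
have -> : (4%:Z * (f u * f v) - (f (u + 1) * f v + f (u - 1) * f v +
   f u * f (v + 1) + f u * f (v - 1)) = 2 * f u + 2 * f v)%R.
  by rewrite /f; ring.
lia.
Qed.

(** The mass weighted by a superharmonic function decreases at each toppling. *)
Lemma stabilizing_exists (eta : sandpile L) : exists s, stabilizing eta s.
Proof.
have [h hh] := superharmonic_exists.
pose Phi (e : sandpile L) := \sum_y h y * e y.
have [m] := ubnP (Phi eta); elim: m eta => // m IH eta; rewrite ltnS => le.
have [st|] := boolP (is_stable eta); first by exists [::].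
rewrite negb_forall => /existsP[x]; rewrite -leqNgt => le4.
suff lt : Phi (topple x eta) < Phi eta.
  have [s /andP[ls ss]] := IH _ (leq_trans lt le).
  by exists (x :: s); rewrite /stabilizing /= le4 ls ss.
rewrite -(ltn_add2r (4 * h x)).
have -> : Phi (topple x eta) + 4 * h x = Phi eta + \sum_z nbr x z * h z.
  have -> : 4 * h x = \sum_y h y * (4 * (y == x)).
    rewrite (bigD1 x) //= eqxx big1 ?addn0 ?muln1 1?mulnC // => y /negPf ->.
    by rewrite !muln0.
  rewrite -!big_split; apply: eq_bigr => y _ /=.
  by rewrite -mulnDr toppleE // mulnDr neighbour_sym (mulnC (h y) (nbr _ _)).
by rewrite ltn_add2l.
Qed.

Lemma add_particle_stabilizes x (eta : stable_sandpile L) :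
  exists xi, stabilizes_to (add_particle x (to_sandpile eta)) xi.
Proof.
have [s hs] := stabilizing_exists (add_particle x (to_sandpile eta)).
have /andP[_ /forallP st] := hs.
exists [ffun y => inord (topple_seq (add_particle x (to_sandpile eta)) s y)].
by exists s => //; apply/ffunP => y; rewrite !ffunE inordK.
Qed.

Definition add_stab x (eta : stable_sandpile L) : stable_sandpile L :=
  projT1 (cid (add_particle_stabilizes x eta)).

Lemma stabilizes_add_stab x eta :
  stabilizes_to (add_particle x (to_sandpile eta)) (add_stab x eta).
Proof. exact: projT2 (cid (add_particle_stabilizes x eta)). Qed.

Lemma stabilizes_toE x eta xi :
  stabilizes_to (add_particle x (to_sandpile eta)) xi <-> add_stab x eta = xi.
Proof.
split=> [[s hs Es]|<-]; last exact: stabilizes_add_stab.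
have [t ht Et] := stabilizes_add_stab x eta.
have := stabilizing_uniq hs ht; rewrite Es Et => /ffunP E.
by apply/ffunP => y; have := E y; rewrite !ffunE => ?; apply: val_inj.
Qed.

Lemma add_stabE x eta : exists2 s,
  stabilizing (add_particle x (to_sandpile eta)) s &
  forall y, add_stab x eta y + 4 * count_mem y s =
    eta y + (y == x) + \sum_z nbr y z * count_mem z s.
Proof.
have [s hs Es] := stabilizes_add_stab x eta; exists s => // y.
have /andP[ls _] := hs; have := topple_seqE y ls.
by rewrite Es !ffunE.
Qed.

(** * Recurrent sandpiles and last waves *)

Definition recurrent_states : {set stable_sandpile L} :=
  [set eta : stable_sandpile L | recurrent nbr setT (fun=> 4) (fun x => eta x)].

Lemma recurrent_statesP (eta : stable_sandpile L) :
  reflect (forall U, U != set0 -> exists2 x, x \in U & deg nbr U x <= eta x)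
          (eta \in recurrent_states).
Proof.
rewrite inE; apply: (iffP (recurrentP _ _ _ _)) => [[_ h] U|h].
  exact: h (subsetT U).
by split=> [x _|U _]; [exact: ltn_ord | exact: h].
Qed.

(** A vertex that has just toppled can be burnt last: each of its neighbours has
    gained the particle that makes up for its presence. *)
Lemma topple_seq_burnable (eta : sandpile L) s : legal eta s ->
  (forall U, U != set0 -> exists2 x, x \in U & deg nbr U x <= eta x) ->
  (forall U, U != set0 -> exists2 x, x \in U & deg nbr U x <= topple_seq eta s x).
Proof.
elim: s eta => [//|x s IH] eta /= /andP[le4 ls] h; apply: IH ls _ => U U0.
have [y yU ley] : exists2 y, y \in U & deg nbr U y <= topple x eta y.
  have [xU|xU] := boolP (x \in U); last first.
    have [y yU ley] := h U U0; exists y => //; apply: leq_trans ley _.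
    by rewrite ffunE ifN ?leq_addr //; apply: contraNneq xU => <-.
  have [D0|D0] := eqVneq (U :\ x) set0.
    exists x => //; suff -> : deg nbr U x = 0 by [].
    by rewrite -(degD1 neighbour_irr) D0 /deg big_set0.
  have [y] := h _ D0; rewrite !inE => /andP[yx yU] ley; exists y => //.
  rewrite ffunE (negPf yx) /deg (bigD1 x) //= addnC neighbour_sym leq_add2r.
  apply: leq_trans ley; apply: eq_leq; apply: eq_bigl => z.
  by rewrite !inE andbC.
by exists y.
Qed.

Lemma add_stab_recurrent x eta :
  eta \in recurrent_states -> add_stab x eta \in recurrent_states.
Proof.
move=> /recurrent_statesP h; apply/recurrent_statesP => U U0.
have [s /andP[ls _] Es] := stabilizes_add_stab x eta.
have [|y yU ley] := topple_seq_burnable ls _ U0.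
  move=> W W0; have [y yW ley] := h W W0; exists y => //.
  by rewrite !ffunE (leq_trans ley) ?leq_addr.
by exists y; rewrite // Es ffunE in ley *.
Qed.

Local Open Scope ring_scope.

(** The set where M is maximal.  If M is the difference of two numbers of
    topplings, then on this set the first process removes at least
    4 - deg U x particles more than the second, which the burning criterion
    does not allow for all x in U. *)
Lemma max_principle (M : box L -> int) x0 : 0 < M x0 ->
  exists2 U : {set box L}, U != finset.set0 &
    forall x, x \in U -> 0 < M x /\
      4 - (deg nbr U x)%:Z <= 4 * M x - \sum_y (nbr x y)%:Z * M y.
Proof.
move=> M0; have [x1 _ M1] := @arg_maxP _ _ _ x0 predT M isT.
pose U := [set x | M x == M x1]%SET.
have pos : 0 < M x1 by apply: lt_le_trans M0 (M1 x0 isT).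
exists U; first by apply/finset.set0Pn; exists x1; rewrite inE.
move=> x; rewrite inE => /eqP Mx; split; first by rewrite Mx.
have le : \sum_y (nbr x y)%:Z * M y <=
    (deg nbr setT x)%:Z * (M x1 - 1) + (deg nbr U x)%:Z.
  rewrite !deg_sumE !(big_morph _ PoszD (erefl _)) mulr_suml -big_split /=.
  apply: ler_sum => y _; rewrite !inE muln1.
  have := M1 y isT; case: eqP => [->|ne] le; case: (nbr x y); lia.
have := deg_le4 x setT; have : (0 <= M x1 - 1) by lia.
by rewrite Mx; nia.
Qed.

Lemma add_stab_int x eta : exists2 s,
  stabilizing (add_particle x (to_sandpile eta)) s &
  forall y, (add_stab x eta y)%:Z + 4 * (count_mem y s)%:Z =
    (eta y)%:Z + (y == x)%:Z + \sum_z (nbr y z)%:Z * (count_mem z s)%:Z.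
Proof.
have [s hs E] := add_stabE x eta; exists s => // y.
rewrite -PoszM -PoszD E !PoszD; congr (_ + _).
by rewrite (big_morph _ PoszD (erefl _)).
Qed.

(** Two recurrent sandpiles with the same image differ by the Laplacian of the
    difference of their toppling numbers; by the maximum principle this
    difference is neither positive nor negative anywhere. *)
Lemma add_stab_inj x : {in recurrent_states &, injective (add_stab x)}.
Proof.
move=> e1 e2 r1 r2 E.
have [s1 _ E1] := add_stab_int x e1; have [s2 _ E2] := add_stab_int x e2.
pose M y : int := (count_mem y s1)%:Z - (count_mem y s2)%:Z.
have main y : 4 * M y - \sum_z (nbr y z)%:Z * M z = (e1 y)%:Z - (e2 y)%:Z.
  rewrite /M; under eq_bigr => z _ do rewrite mulrBr.
  rewrite sumrB; have := E1 y; have := E2 y; rewrite E.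
  set a := \sum_(i : box L) _; set b := \sum_(i : box L) _; lia.
have le (N : box L -> int) (f g : stable_sandpile L) : g \in recurrent_states ->
    (forall y, 4 * N y - \sum_z (nbr y z)%:Z * N z = (f y)%:Z - (g y)%:Z) ->
    forall y, N y <= 0.
  move=> /recurrent_statesP gr NE y; rewrite leNgt; apply/negP.
  case/max_principle => U U0 HU; have [z zU lez] := gr U U0.
  have [_] := HU z zU; rewrite NE; have := ltn_ord (f z); lia.
have M0 y : M y = 0.
  apply/eqP; rewrite eq_le (le M e1 e2) //=.
  rewrite -oppr_le0 (le (fun y => - M y) e2 e1) // => z.
  under eq_bigr => t _ do rewrite mulrN.
  rewrite sumrN; have := main z; set a := \sum_(i : box L) _; lia.
apply/ffunP => y; apply: val_inj => /=; have := main y.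
rewrite M0 big1 => [|z _]; last by rewrite M0 mulr0.
by move/eqP; rewrite mulr0 subr0 eq_sym subr_eq0 => /eqP[].
Qed.

(** If the final configuration looks as if W had toppled in the last wave, then
    the avalanche did topple W.  Otherwise apply the maximum principle to the
    indicator of W minus the number of topplings: undoing the wave W would leave
    a vertex other than x with more than 3 particles, or x with more than 4. *)
Lemma wave_topples x (eta : stable_sandpile L) (W : {set box L}) :
  eta \in recurrent_states -> x \in W ->
  (add_stab x eta x = deg nbr W x :> nat) ->
  (forall y, y \in W -> y != x -> (add_stab x eta y < deg nbr W y)%N) ->
  forall y, y \in W ->
    topples_in_stabilization (add_particle x (to_sandpile eta)) y.
Proof.
move=> /recurrent_statesP er xW etax low y yW.
have [s hs E] := add_stab_int x eta; exists s => //.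
rewrite -has_pred1 has_count lt0n; apply: contraT; rewrite negbK => /eqP cy.
pose M z : int := (z \in W)%:Z - (count_mem z s)%:Z.
have My : 0 < M y by rewrite /M yW cy.
have [U U0 HU] := max_principle My; have [z zU lez] := er U U0.
have [Mz] := HU z zU; rewrite /M; under eq_bigr => t _ do rewrite mulrBr.
have -> : \sum_t ((nbr z t)%:Z * (t \in W)%:Z - (nbr z t)%:Z * (count_mem t s)%:Z)
   = (deg nbr W z)%:Z - \sum_t (nbr z t)%:Z * (count_mem t s)%:Z.
  by rewrite sumrB deg_sumE (big_morph _ PoszD (erefl _)).
have zW : z \in W by move: Mz; rewrite /M; case: (z \in W) => //=; lia.
have := E z; move: lez; rewrite zW; move: (\sum_t _) => S.
have [->|zx] := eqVneq z x; last by have := low z zW zx; lia.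
by rewrite etax; lia.
Qed.

Local Close Scope ring_scope.

Definition top_state : stable_sandpile L := [ffun=> inord 3].

(** In a set U the vertex of least superharmonic weight has at most three
    neighbours. *)
Lemma top_state_recurrent : top_state \in recurrent_states.
Proof.
apply/recurrent_statesP => U /finset.set0Pn[x xU].
have [h hh] := superharmonic_exists.
have [y yU ymin] := @arg_minnP _ x (mem U) h xU; exists y => //.
rewrite ffunE inordK // -ltnS -(@ltn_pmul2r (h y)); last first.
  by have := hh y; case: (h y) => //; rewrite muln0.
apply: leq_ltn_trans (hh y); rewrite /deg big_distrl [leqRHS](bigID (mem U)) /=.
apply: leq_trans (leq_addr _ _); apply: leq_sum => z zU.
by rewrite leq_mul2l ymin ?orbT.
Qed.

Lemma add_stab_surj x xi : xi \in recurrent_states ->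
  exists2 eta, eta \in recurrent_states & add_stab x eta = xi.
Proof.
have : add_stab x @: recurrent_states = recurrent_states.
  apply/eqP; rewrite eqEcard (card_in_imset (@add_stab_inj x)) leqnn andbT.
  by apply/subsetP => _ /imsetP[eta er ->]; apply: add_stab_recurrent.
by move=> {1}<- /imsetP[eta er ->]; exists eta.
Qed.

Lemma add_stab_low x (eta : stable_sandpile L) : eta x < 3 ->
  forall y, add_stab x eta y = eta y + (y == x) :> nat.
Proof.
move=> lt3; suff <- : [ffun y => inord (eta y + (y == x))] = add_stab x eta.
  move=> y; rewrite ffunE inordK //.
  by case: eqP => [->|_]; rewrite ?addn1 ?addn0 // ltn_ord.
have lt4 y : eta y + (y == x) < 4.
  by case: eqP => [->|_]; rewrite ?addn1 ?addn0 // ltn_ord.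
apply/esym/stabilizes_toE; exists [::].
  by apply/forallP => y; rewrite !ffunE.
by apply/ffunP => y; rewrite !ffunE inordK.
Qed.

Section LastWave.
Variables (o e : box L).
Hypothesis oe : nbr o e.

(** A wave from o that misses the neighbour e leaves o with deg W o <= 3
    particles, hence a recurrent sandpile.  This sandpile is the outcome of a
    unique avalanche from o between recurrent sandpiles, and the avalanche
    contains the wave. *)
Lemma card_last_waves y :
  #|[set g in recurrent_configs nbr 4 ([set: box L] :\ o) (fun=> 4) |
      (y \in imprint nbr setT o (val_of g)) &&
      (e \notin imprint nbr setT o (val_of g))]| <=
  #|[set eta in recurrent_states |
      `[< topples_in_stabilization (add_particle o (to_sandpile eta)) y >]]|.
Proof.
set K := [set g in _ | _]; set A := [set eta in _ | _].
(* The configuration after the wave, with the height that o then has. *)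
pose j (g : {ffun box L -> 'I_5}) : stable_sandpile L :=
  [ffun x => inord (if x == o then deg nbr (imprint nbr setT o (val_of g)) o
                    else val_of g x)].
have jE g x : g \in K -> j g x = (if x == o then
    deg nbr (imprint nbr setT o (val_of g)) o else val_of g x) :> nat.
  rewrite inE => /and3P[/recurrent_configsP[/recurrentP[gd _] _] _ eW].
  rewrite ffunE inordK //; case: eqP => [_|/eqP xo].
    apply: leq_trans (deg_le4 o setT).
    rewrite (degDS _ _ (subsetT (e |: imprint nbr setT o (val_of g)))).
    rewrite /deg big_setU1 //= oe; lia.
  by apply: gd; rewrite !inE xo.
have jr g : g \in K -> j g \in recurrent_states.
  move=> gK; have := gK; rewrite [g \in K]inE => /and3P[/recurrent_configsP[gr _] _ _].
  have E : {in [set: box L], (fun x => j g x : nat) =1 (fun x => if x == o then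
      deg nbr (imprint nbr setT o (val_of g)) o else val_of g x)}.
    by move=> x _; exact: jE.
  rewrite inE (eq_recurrent _ E (fun _ _ => erefl)).
  rewrite (recurrent_root _ (finset.in_setT o) gr) leqnn /=.
  by have := jE g o gK; rewrite eqxx => <-.
have jI : {in K &, injective j}.
  move=> g g' gK gK' E; apply/ffunP => x; apply: val_inj.
  have := jE g x gK; rewrite E jE //.
  case: eqP => [->|//] _.
  have zero h : h \in K -> h o = ord0.
    by rewrite inE => /andP[/recurrent_configsP[_ ->]]; rewrite // !inE eqxx.
  by rewrite !zero.
rewrite -(card_in_imset jI); apply: leq_trans (leq_imset_card (add_stab o) A).
apply: subset_leq_card; apply/subsetP => _ /imsetP[g gK ->].
have [eta er E] := add_stab_surj o (jr g gK).
apply/imsetP; exists eta => //; rewrite inE er /=; apply/asboolP.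
have := gK; rewrite [g \in K]inE => /and3P[_ yW _].
have [_ oW low _] := imprintP nbr (val_of g) (finset.in_setT o).
apply: (wave_topples er oW) yW; first by rewrite E jE // eqxx.
by move=> z zW zo; rewrite E jE // (negPf zo) low.
Qed.

Lemma wave_count_gap y :
  wave_count nbr 4 setT (fun=> 4) o y <= wave_count nbr 4 setT (fun=> 4) e y +
  #|[set eta in recurrent_states |
      `[< topples_in_stabilization (add_particle o (to_sandpile eta)) y >]]|.
Proof.
apply: leq_trans (leq_add (leqnn _) (card_last_waves y)).
apply: (wave_count_le neighbour_sym neighbour_irr) => //.
- by move=> U x; apply: deg_le4.
- by move=> x _; apply: deg_le4.
Qed.
End LastWave.

Lemma card_recurrent_states :
  #|recurrent_states| <= #|recurrent_configs nbr 4 [set: box L] (fun=> 4)|.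
Proof.
pose w (eta : stable_sandpile L) : {ffun box L -> 'I_5} :=
  [ffun x => widen_ord (leqnSn 4) (eta x)].
have wI : injective w.
  move=> a b /ffunP E; apply/ffunP => x; apply: val_inj.
  by have /(congr1 val) := E x; rewrite !ffunE.
rewrite -(card_imset _ wI); apply: subset_leq_card.
apply/subsetP => _ /imsetP[eta er ->]; apply/recurrent_configsP; split.
  have E : {in [set: box L], val_of (w eta) =1 (fun x => eta x : nat)}.
    by move=> x _; rewrite /val_of ffunE.
  by rewrite (eq_recurrent _ E (fun _ _ => erefl)); rewrite inE in er.
by move=> x; rewrite inE.
Qed.

(** * Stationary distributions are uniform on the recurrent sandpiles *)

Section Stationary.
Variables (R : realType) (nu : stable_sandpile L -> R).
Hypothesis nu_st : is_stationary nu.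
Local Open Scope ring_scope.

Let nu_ge0 eta : 0 <= nu eta.
Proof. by have [[]] := nu_st. Qed.

Let N : R := #|box L|%:R.

Let N_gt0 : 0 < N.
Proof. by rewrite ltr0n; apply/card_gt0P; exists (origin L). Qed.

Lemma stationaryE xi :
  N * nu xi = \sum_(x : box L) \sum_(eta | add_stab x eta == xi) nu eta.
Proof.
have [_ <-] := nu_st; rewrite big_distrr /=.
transitivity (\sum_eta \sum_(x | add_stab x eta == xi) nu eta).
  apply: eq_bigr => eta _; rewrite /transition mulrCA.
  rewrite (eq_bigl (fun x => add_stab x eta == xi)); last first.
    by move=> x; apply/asboolP/eqP => /stabilizes_toE.
  rewrite !big_distrr /=; apply: eq_bigr => x _.
  by rewrite mulfV ?mulr1 // gt_eqF.
by rewrite (exchange_big_dep xpredT).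
Qed.

Lemma nu_add_stab_gt0 x eta : 0 < nu eta -> 0 < nu (add_stab x eta).
Proof.
move=> pos; rewrite -(pmulr_rgt0 _ N_gt0) stationaryE (bigD1 x) //=.
rewrite (bigD1 eta) //= -addrA ltr_pwDl // addr_ge0 //.
  by apply: sumr_ge0.
by apply: sumr_ge0 => z _; apply: sumr_ge0.
Qed.

(** The recurrent sandpiles are never left, so no mass can flow into them. *)
Lemma nu_add_stab_transient x eta : eta \notin recurrent_states ->
  add_stab x eta \in recurrent_states -> nu eta = 0.
Proof.
set C := recurrent_states => etaC aC.
have EC : N * \sum_(xi in C) nu xi =
    \sum_(y : box L) \sum_(xi | add_stab y xi \in C) nu xi.
  rewrite big_distrr /= (eq_bigr _ (fun xi _ => stationaryE xi)).
  rewrite exchange_big /=; apply: eq_bigr => y _.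
  rewrite (exchange_big_dep (fun xi => add_stab y xi \in C)) /=; last first.
    by move=> xi eta' xiC /eqP ->.
  apply: eq_bigr => xi aCxi.
  rewrite (big_pred1 (add_stab y xi)) // => z.
  by rewrite eq_sym andb_idl // => /eqP ->.
have split_ y : \sum_(xi | add_stab y xi \in C) nu xi =
    \sum_(xi in C) nu xi + \sum_(xi | (add_stab y xi \in C) && (xi \notin C)) nu xi.
  rewrite (bigID (mem C)) /=; congr (_ + _); apply: eq_bigl => xi.
  by rewrite andb_idl //; apply: add_stab_recurrent.
move: EC; rewrite [RHS](eq_bigr _ (fun y _ => split_ y)).
rewrite big_split /= sumr_const -mulr_natl => /eqP.
rewrite -subr_eq0 opprD addrA subrr sub0r oppr_eq0.
rewrite psumr_eq0 => [/allP /(_ x)|y _]; last exact: sumr_ge0.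
rewrite mem_index_enum => /(_ isT) /=; rewrite psumr_eq0 // => /allP/(_ eta).
by rewrite mem_index_enum aC etaC => /(_ isT) /eqP.
Qed.

Let height (eta : stable_sandpile L) : nat := \sum_(x : box L) eta x.

Lemma height_add_stab x (eta : stable_sandpile L) : (eta x < 3)%N ->
  height (add_stab x eta) = (height eta).+1.
Proof.
move=> lt3; rewrite /height (eq_bigr _ (fun y _ => add_stab_low lt3 y)).
rewrite big_split /=; have -> : (\sum_(y : box L) (y == x) = 1)%N.
  by rewrite (bigD1 x) //= eqxx big1 // => y /negPf ->.
by rewrite addn1.
Qed.

Lemma top_stateP eta : eta = top_state \/ exists x, (eta x < 3)%N.
Proof.
have [/forallP h|] := boolP [forall x, eta x == 3 :> nat].
  left; apply/ffunP => x; apply: val_inj.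
  by rewrite /= /top_state ffunE inordK //; apply/eqP.
rewrite negb_forall => /existsP[x ne]; right; exists x.
by have := ltn_ord (eta x); rewrite ltnS leq_eqVlt (negPf ne).
Qed.

(** Take the transient sandpile of positive mass with the most particles.  A
    particle added at a vertex of height less than 3 gives another one, which is
    transient as well and has more particles. *)
Lemma nu_transient eta : eta \notin recurrent_states -> nu eta = 0.
Proof.
move=> etaC; apply/eqP; apply: contraT => nz.
pose P := [pred xi | (nu xi != 0) && (xi \notin recurrent_states)].
have P0 : P eta by rewrite /= nz.
have [xi /andP[xi0 xiC] ximax] := @arg_maxnP _ eta P height P0.
have xipos : 0 < nu xi by rewrite lt_neqAle eq_sym xi0 nu_ge0.
have [xiT|[x lt3]] := top_stateP xi; first by rewrite xiT top_state_recurrent in xiC.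
have := ximax (add_stab x xi); rewrite /= gt_eqF ?nu_add_stab_gt0 //=.
have -> : add_stab x xi \notin recurrent_states.
  by apply: contra xi0 => /(nu_add_stab_transient xiC) ->.
by move/(_ isT); rewrite height_add_stab // ltnn.
Qed.

(** Stationarity makes nu harmonic for the permutations [add_stab x] of the
    recurrent sandpiles.  The set of maximisers is therefore stable under their
    inverses, thus under the permutations, and every recurrent sandpile leads to
    the full one by adding particles. *)
Lemma nu_recurrent eta xi : eta \in recurrent_states -> xi \in recurrent_states ->
  nu eta = nu xi.
Proof.
pose C := recurrent_states.
have [x0 x0C x0max] := @arg_maxP _ _ _ top_state (mem C) nu top_state_recurrent.
set m := nu x0 in x0max.
have le_m zeta : nu zeta <= m.
  by have [/x0max|/nu_transient ->] := boolP (zeta \in C); rewrite ?nu_ge0.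
have fib x zeta : zeta \in C ->
    \sum_(zeta' | add_stab x zeta' == add_stab x zeta) nu zeta' = nu zeta.
  move=> zC; rewrite (bigD1 zeta) //= big1 ?addr0 // => z /andP[/eqP E ne].
  have [zr|/nu_transient //] := boolP (z \in C).
  by case/eqP: ne; apply: add_stab_inj E.
pose M := [set zeta in C | nu zeta == m].
have inM zeta : (zeta \in M) = (zeta \in C) && (nu zeta == m) by rewrite inE.
have back x zeta : zeta \in C -> add_stab x zeta \in M -> zeta \in M.
  rewrite !inM => zC /andP[aC /eqP am]; rewrite zC /=.
  have : \sum_(y : box L) (m - \sum_(z | add_stab y z == add_stab x zeta) nu z) = 0.
    by rewrite sumrB -stationaryE am sumr_const -mulr_natl subrr.
  move/eqP; rewrite psumr_eq0 => [/allP/(_ x)|y _]; last first.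
    have [z zr <-] := add_stab_surj y aC.
    by rewrite fib // subr_ge0.
  by rewrite mem_index_enum => /(_ isT); rewrite fib // subr_eq0 eq_sym.
have fwd x zeta : zeta \in M -> add_stab x zeta \in M.
  pose A := [set z in C | add_stab x z \in M].
  have inA (z : stable_sandpile L) : (z \in A) = (z \in C) && (add_stab x z \in M) by rewrite finset.in_set.
  have AM : A = M.
    apply/eqP; rewrite eqEcard; apply/andP; split.
      by apply/subsetP => z; rewrite inE => /andP[zC zM]; apply: back zM.
    apply: leq_trans (leq_imset_card (add_stab x) A); apply: subset_leq_card.
    apply/subsetP => z zM; have := zM; rewrite inM => /andP[zC _].
    have [w wC E] := add_stab_surj x zC; apply/imsetP; exists w => //.
    by rewrite inA wC E.
  by rewrite -{1}AM inA => /andP[].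
have top zeta : zeta \in C -> (zeta \in M) = (top_state \in M).
  have [k] := ubnP (12 * #|box L| - height zeta)%N.
  elim: k zeta => // k IH zeta; rewrite ltnS => le zC.
  have [->//|[x lt3]] := top_stateP zeta.
  have E : (zeta \in M) = (add_stab x zeta \in M).
    by apply/idP/idP => [/fwd|/back]; apply.
  rewrite E IH ?add_stab_recurrent // height_add_stab //.
  suff : (height zeta < 12 * #|box L|)%N by move: le; lia.
  have : (height (add_stab x zeta) <= #|box L| * 3)%N.
    rewrite -sum_nat_const; apply: leq_sum => y _; rewrite -ltnS; exact: ltn_ord.
  by rewrite height_add_stab //; lia.
have topM : top_state \in M by rewrite -(top x0 x0C) inM eqxx andbT.
have allm zeta : zeta \in C -> nu zeta = m.
  by move=> zC; move: topM; rewrite -(top zeta) // inM => /andP[_ /eqP].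
by move=> eC xC; rewrite !allm.
Qed.

Lemma card_recurrent_gt0 : (0 < #|recurrent_states|)%N.
Proof. by apply/card_gt0P; exists top_state; apply: top_state_recurrent. Qed.

Lemma nu_uniform (A : {set stable_sandpile L}) : A \subset recurrent_states ->
  #|recurrent_states|%:R * \sum_(eta in A) nu eta = #|A|%:R.
Proof.
move=> sA; have c0 : #|recurrent_states|%:R != 0 :> R.
  by rewrite pnatr_eq0 -lt0n card_recurrent_gt0.
have E eta : eta \in recurrent_states -> nu eta = #|recurrent_states|%:R^-1.
  move=> er; have [[_ s1] _] := nu_st; move: s1.
  rewrite (bigID (mem recurrent_states)) /= [X in _ + X]big1 => [|xi]; last first.
    exact: nu_transient.
  rewrite addr0 (eq_bigr (fun=> nu eta)) => [|xi xr]; last exact: nu_recurrent.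
  by rewrite sumr_const => s1; apply: (mulIf c0); rewrite mulVf // mulr_natr.
rewrite (eq_bigr (fun=> #|recurrent_states|%:R^-1)) => [|eta eA]; last first.
  by rewrite E // (subsetP sA).
by rewrite sumr_const mulrnAr mulfV.
Qed.
End Stationary.

(** * The gradient of the Green function *)

Section Potential.
Local Open Scope ring_scope.

(** The heights range over 0..4 because [recurrent_configs_card_root], applied to
    a set in which a vertex has four neighbours, needs a fifth height. *)
Definition recurrent_count : nat := #|recurrent_configs nbr 4 [set: box L] (fun=> 4%N)|.

Definition potential z y : nat := wave_count nbr 4 [set: box L] (fun=> 4%N) z y.

Definition toppling_count y : nat :=
  #|[set eta in recurrent_states |
      `[< topples_in_stabilization (add_particle (origin L) (to_sandpile eta)) y >]]|.

Definition laplacian (g : box L -> int) y : int :=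
  4 * g y - \sum_w (nbr y w)%:Z * g w.

Lemma recurrent_count_gt0 : (0 < recurrent_count)%N.
Proof. exact: leq_trans card_recurrent_gt0 card_recurrent_states. Qed.

Lemma laplacian_potential z y :
  laplacian (fun w => (potential z w)%:Z) y = (y == z)%:Z * recurrent_count%:Z.
Proof.
have sumE : (\sum_w nbr y w * potential z w)%N%:Z =
    \sum_w (nbr y w)%:Z * (potential z w)%:Z by rewrite (big_morph _ PoszD (erefl _)).
rewrite /laplacian -sumE; have dB x : x \in [set: box L] -> (deg nbr setT x <= 4)%N.
  by move=> _; apply: deg_le4.
have [->|yz] := eqVneq y z.
  have := @wave_count_root _ _ 4 _ _ _ (finset.in_setT z) dB (fun=> isT).
  rewrite -/(potential z z) -/recurrent_count => /(congr1 Posz).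
  by rewrite PoszM PoszD mul1r => ->; rewrite addrK.
have := wave_count_harmonic neighbour_irr (finset.in_setT z) dB (fun=> isT : (4 <= 5)%N) (finset.in_setT y) yz.
by rewrite /potential => <-; rewrite PoszM subrr mul0r.
Qed.

Lemma potential_sym z y : potential z y = potential y z.
Proof.
apply/eqP; rewrite -(eqn_pmul2l recurrent_count_gt0); apply/eqP.
apply: (wave_count_sym neighbour_sym neighbour_irr (n := 4)) => //.
by move=> x _; apply: deg_le4.
Qed.

(** Green's identity: the boundary terms vanish for the Dirichlet Laplacian. *)
Lemma sum_laplacian (g : box L -> int) z :
  \sum_y laplacian g y * (potential z y)%:Z = recurrent_count%:Z * g z.
Proof.
transitivity (\sum_y g y * laplacian (fun w => (potential z w)%:Z) y).
  rewrite /laplacian; under eq_bigr => y _ do rewrite mulrBl.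
  under [RHS]eq_bigr => y _ do rewrite mulrBr.
  rewrite !sumrB; congr (_ - _); first by apply: eq_bigr => y _; ring.
  under eq_bigr => y _ do rewrite mulr_suml.
  under [RHS]eq_bigr => y _ do rewrite mulr_sumr.
  rewrite exchange_big; apply: eq_bigr => y _; apply: eq_bigr => w _.
  by rewrite neighbour_sym; ring.
rewrite (bigD1 z) //= big1 ?addr0 => [|y /negPf yz].
  by rewrite laplacian_potential eqxx mul1r mulrC.
by rewrite laplacian_potential yz mul0r mulr0.
Qed.

(** The four differences over the neighbours of the origin have sum 0, so each of
    them is at least minus the sum of the upper bounds for the other three. *)
Lemma potential_gap_abs e y : (0 < L)%N -> nbr (origin L) e -> y != origin L ->
  `|(potential (origin L) y)%:Z - (potential e y)%:Z| <= 3 * (toppling_count y)%:Z.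
Proof.
move=> L0 oe yo; set o := origin L in oe yo *.
pose D w : int := (potential o y)%:Z - (potential w y)%:Z.
have upper w : nbr o w -> D w <= (toppling_count y)%:Z.
  by move=> ow; rewrite /D lerBlDl -PoszD lez_nat; apply: wave_count_gap.
have sum0 : \sum_w (nbr o w)%:Z * D w = 0.
  have := laplacian_potential y o; rewrite eq_sym (negPf yo) mul0r /laplacian => lap.
  rewrite -[RHS]lap /D; under eq_bigr => w _ do rewrite mulrBr.
  rewrite sumrB; congr (_ - _); last by apply: eq_bigr => w _; rewrite potential_sym.
  rewrite -mulr_suml potential_sym; congr (_ * _).
  rewrite -[RHS]/(4%N%:Z) -(deg_origin L0) deg_sumE (big_morph _ PoszD (erefl _)).
  by apply: eq_bigr => w _; rewrite inE muln1.
have deg3 : \sum_(w | w != e) (nbr o w)%:Z = 3.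
  have : \sum_w (nbr o w)%:Z = 4.
    rewrite -[RHS]/(4%N%:Z) -(deg_origin L0) deg_sumE (big_morph _ PoszD (erefl _)).
    by apply: eq_bigr => w _; rewrite inE muln1.
  by rewrite (bigD1 e) //= oe; set S := \sum_(i | _) _; lia.
have lower : - D e <= 3 * (toppling_count y)%:Z.
  move: sum0; rewrite (bigD1 e) //= oe mul1r => /eqP.
  rewrite addr_eq0 => /eqP ->; rewrite opprK -deg3 mulr_suml.
  by apply: ler_sum => w _; case ow: (nbr o w); rewrite ?mul0r // !mul1r upper.
rewrite ler_norml lerNl lower /=.
by have := upper e oe; rewrite -/(D e); lia.
Qed.

Lemma test_function_bound e (g : box L -> int) : (0 < L)%N -> nbr (origin L) e ->
  laplacian g (origin L) = 0 ->
  recurrent_count%:Z * `|g (origin L) - g e| <=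
  \sum_(y | y != origin L) `|laplacian g y| * (3 * (toppling_count y)%:Z).
Proof.
move=> L0 oe lap0; set o := origin L in oe lap0 *.
have -> : recurrent_count%:Z * `|g o - g e| =
    `|\sum_y laplacian g y * ((potential o y)%:Z - (potential e y)%:Z)|.
  under eq_bigr => y _ do rewrite mulrBr.
  by rewrite sumrB !sum_laplacian -mulrBr normrM.
rewrite (bigD1 o) //= lap0 mul0r add0r; apply: le_trans (ler_norm_sum _ _ _) _.
apply: ler_sum => y yo; rewrite normrM; apply: ler_wpM2l => //.
exact: potential_gap_abs.
Qed.

(** * The test function and the resulting lower bound *)

Definition sup_norm y : nat := maxn (absz (coord1 y)) (absz (coord2 y)).

Lemma sup_norm_le (m : nat) y : (sup_norm y <= m)%N =
  (`|coord1 y| <= m%:Z) && (`|coord2 y| <= m%:Z).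
Proof. by rewrite /sup_norm geq_max -!lez_nat !abszE. Qed.

Lemma sup_norm_eq0 y : (sup_norm y == 0)%N = (y == origin L).
Proof.
have [o1 o2] := coord_origin L.
apply/idP/eqP => [|->]; last by rewrite /sup_norm o1 o2.
rewrite -leqn0 sup_norm_le => h.
by apply: coord_inj; rewrite ?o1 ?o2; lia.
Qed.

Definition bump (m : int) y : int := bump_odd m (coord1 y) * bump_even m (coord2 y).

Lemma laplacian_bump (m : nat) y (s := coord1 y) (t := coord2 y) : (m <= L)%N ->
  laplacian (bump m) y =
  second_diff (bump_odd m) s * bump_even m t +
  bump_odd m s * second_diff (bump_even m) t.
Proof.
move=> mL; rewrite /laplacian /bump.
rewrite (@sum_neighbours (fun u v => bump_odd m u * bump_even m v)).
  by rewrite -/s -/t /second_diff; ring.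
move=> u v [] h; first by rewrite bump_odd_out ?mul0r //; lia.
by rewrite bump_even_out ?mulr0 //; lia.
Qed.

Lemma laplacian_bump_le (m : nat) y : (0 < m)%N -> (m <= L)%N ->
  `|laplacian (bump m) y| <= ((sup_norm y <= m)%N)%:Z * (14 * m%:Z ^+ 5).
Proof.
move=> m0 mL; rewrite laplacian_bump //; set s := coord1 y; set t := coord2 y.
have [le|gt] := boolP (sup_norm y <= m)%N; last first.
  rewrite mul0r normr_le0.
  move: gt; rewrite sup_norm_le negb_and -!ltNge -/s -/t => /orP[] h.
    rewrite (second_diff_out _ h) ?mul0r ?add0r; last exact: bump_odd_out.
    by rewrite bump_odd_out ?mul0r // ltW.
  rewrite (second_diff_out _ h) ?mulr0 ?addr0; last exact: bump_even_out.
  by rewrite bump_even_out ?mulr0 // ltW.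
rewrite mul1r; apply: le_trans (ler_normD _ _) _; rewrite !normrM.
have mge : 0 <= m%:Z by [].
apply: le_trans (lerD (ler_pM _ _ (second_diff_odd_le s mge) (bump_even_le t mge))
  (ler_pM _ _ (bump_odd_le s mge) (second_diff_even_le t mge))) _ => //.
have -> : 4 * m%:Z * m%:Z ^+ 4 + m%:Z ^+ 3 * (8 * m%:Z ^+ 2 + 2) =
   12 * m%:Z ^+ 5 + 2 * m%:Z ^+ 3 by ring.
have -> : 14 * m%:Z ^+ 5 = 12 * m%:Z ^+ 5 + 2 * m%:Z ^+ 5 by ring.
by rewrite lerD2l ler_pM2l // ler_weXn2l //; lia.
Qed.

(** The test function takes the values 0 at the origin and (m - 1)^2 m^4 at its
    neighbour e, and its Laplacian is bounded by 14 m^5. *)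
Lemma toppling_count_ball (m : nat) : (0 < m)%N -> (m <= L)%N ->
  recurrent_count%:Z * (m%:Z - 1) ^+ 2 <=
  42 * m%:Z * \sum_(y : box L | (0 < sup_norm y <= m)%N) (toppling_count y)%:Z.
Proof.
move=> m0 mL; have L0 : (0 < L)%N by apply: leq_trans mL.
have [o1 o2] := coord_origin L.
have [e [e1 e2]] : exists e : box L, coord1 e = 1 /\ coord2 e = 0.
  by apply: box_of_coord; rewrite ?normr1 ?normr0 ?lez_nat.
have oe : nbr (origin L) e by rewrite /neighbour o1 o2 e1 e2.
have lap0 : laplacian (bump m) (origin L) = 0.
  rewrite laplacian_bump // o1 o2 second_diff_odd0 mul0r add0r.
  by rewrite bump_odd0 mul0r.
have m4 : 0 < m%:Z ^+ 4 by rewrite exprn_gt0.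
have := test_function_bound L0 oe lap0.
rewrite /bump o1 o2 e1 e2 bump_odd0 mul0r sub0r normrN.
rewrite bump_oddE // bump_evenE // expr0n subr0 mul1r normrM !normrX -!exprM.
rewrite [`|m%:Z|]ger0_norm // (@ger0_norm _ (m%:Z - 1)); last by rewrite subr_ge0.
move=> le; rewrite -(ler_pM2r m4) -[leLHS]mulrA; apply: le_trans le _.
apply: le_trans (_ : \sum_(y | y != origin L) (((sup_norm y <= m)%N)%:Z *
    (14 * m%:Z ^+ 5)) * (3 * (toppling_count y)%:Z) <= _).
  by apply: ler_sum => y _; apply: ler_wpM2r => //; apply: laplacian_bump_le.
rewrite mulr_sumr mulr_suml [leRHS]big_mkcond [leLHS]big_mkcond /=.
apply: ler_sum => y _; rewrite lt0n sup_norm_eq0.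
case: (y == _) => //=; case: (sup_norm y <= m)%N; last by rewrite !mul0r.
by rewrite mul1r le_eqVlt; apply/orP; left; apply/eqP; ring.
Qed.
End Potential.

(** A vertex of the sphere is given by one of four sides and by a position on this
    side, that is, by one of 4 (2 k + 1) <= 12 k pairs. *)
Lemma card_sphere k : 0 < k -> #|[set y : box L | sup_norm y == k]| <= 12 * k.
Proof.
move=> k0.
pose f (y : box L) : 'I_4 * 'I_(2 * k).+1 :=
  let s := coord1 y in let t := coord2 y in
  if (s == k%:Z)%R then (inord 0, inord (absz (t + k%:Z)%R))
  else if s == (- k%:Z)%R then (inord 1, inord (absz (t + k%:Z)%R))
  else if (t == k%:Z)%R then (inord 2, inord (absz (s + k%:Z)%R))
  else (inord 3, inord (absz (s + k%:Z)%R)).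
have fI : {in [set y : box L | sup_norm y == k] &, injective f}.
  move=> y z; rewrite !inE /sup_norm => yk zk; rewrite /f /=.
  have i_inj (a b : nat) : a < 4 -> b < 4 -> (inord a : 'I_4) = inord b -> a = b.
    by move=> a4 b4 /(congr1 val); rewrite /= !inordK.
  have j_inj (u v : int) : (`|u| <= k%:Z)%R -> (`|v| <= k%:Z)%R ->
      (inord (absz (u + k%:Z)%R) : 'I_(2 * k).+1) = inord (absz (v + k%:Z)%R) -> u = v.
    move=> hu hv /(congr1 val); rewrite /= !inordK; lia.
  have [y1 y2] : (`|coord1 y| <= k%:Z /\ `|coord2 y| <= k%:Z)%R by lia.
  have [z1 z2] : (`|coord1 z| <= k%:Z /\ `|coord2 z| <= k%:Z)%R by lia.
  have fin (a b : nat) u v : a < 4 -> b < 4 ->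
      (`|u| <= k%:Z)%R -> (`|v| <= k%:Z)%R ->
      (inord a : 'I_4, inord (absz (u + k%:Z)%R) : 'I_(2 * k).+1) =
      (inord b, inord (absz (v + k%:Z)%R)) -> a = b /\ u = v.
    by move=> a4 b4 hu hv [/(i_inj _ _ a4 b4) -> /(j_inj _ _ hu hv) ->].
  case: ifP => ya; [|case: ifP => yb; [|case: ifP => yc]];
  (case: ifP => za; [|case: ifP => zb; [|case: ifP => zc]]);
  by move/fin => [] // *; apply: coord_inj; lia.
rewrite -(card_in_imset fI); apply: leq_trans (max_card _) _.
by rewrite card_prod !card_ord; lia.
Qed.

(** * The expected radius *)

Section Expectation.
Variables (R : realType) (nu : stable_sandpile L -> R).
Hypothesis nu_st : is_stationary nu.
Local Open Scope ring_scope.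

Definition reaches (k : nat) (eta : stable_sandpile L) : bool :=
  `[< exists2 y, (k <= sup_norm y)%N &
      topples_in_stabilization (add_particle (origin L) (to_sandpile eta)) y >].

Definition tail_prob k : R := \sum_eta nu eta * (reaches k eta)%:R.

Let nu_ge0 eta : 0 <= nu eta.
Proof. by have [[]] := nu_st. Qed.

Lemma tail_prob_ge0 k : 0 <= tail_prob k.
Proof. by apply: sumr_ge0 => eta _; rewrite mulr_ge0 ?nu_ge0 ?ler0n. Qed.

Lemma toppling_count_le k y : (k <= sup_norm y)%N ->
  (toppling_count y)%:R <= #|recurrent_states|%:R * tail_prob k.
Proof.
move=> ky; rewrite /toppling_count; set A := [set eta in _ | _].
rewrite -(nu_uniform nu_st (A := A)); last first.
  by apply/subsetP => eta; rewrite finset.in_set => /andP[].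
apply: ler_wpM2l; rewrite ?ler0n // [leLHS]big_mkcond; apply: ler_sum => eta _.
rewrite finset.in_set; case: ifP => [/andP[_ /asboolP ty]|_].
  suff -> : reaches k eta by rewrite mulr1.
  by apply/asboolP; exists y.
by rewrite mulr_ge0 ?nu_ge0 ?ler0n.
Qed.

Lemma sum_ball (m : nat) (F : nat -> R) : (forall k, 0 <= F k) ->
  \sum_(y : box L | (0 < sup_norm y <= m)%N) F (sup_norm y) <=
  \sum_(1 <= k < m.+1) (12 * k)%:R * F k.
Proof.
move=> F0.
have -> : \sum_(y : box L | (0 < sup_norm y <= m)%N) F (sup_norm y) =
    \sum_(1 <= k < m.+1) \sum_(y : box L | sup_norm y == k) F k.
  rewrite (exchange_big_dep xpredT) //= big_mkcond; apply: eq_bigr => y _.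
  under eq_bigl => k do rewrite eq_sym.
  by rewrite big_nat1_eq ltnS.
apply: ler_sum_nat => k /andP[k0 _].
rewrite sumr_const -[leLHS]mulr_natl ler_wpM2r // ler_nat.
by apply: leq_trans (card_sphere k0); rewrite cardsE.
Qed.

(** Here 2016 = 4 * 42 * 12: 42 is the constant of [toppling_count_ball], 12 that
    of [card_sphere], and m^2 <= 4 (m - 1)^2. *)
Lemma weighted_tail_ge (m : nat) : (1 < m)%N -> (m <= L)%N ->
  m%:R <= 2016 * \sum_(1 <= k < m.+1) k%:R * tail_prob k.
Proof.
move=> m1 mL; have m0 : (0 < m)%N by apply: ltnW.
have := toppling_count_ball m0 mL; rewrite -(ler_int R).
rewrite intrM rmorphXn rmorphB /= !intrM rmorph_sum /= => ball.
set S := \sum_(1 <= k < m.+1) k%:R * tail_prob k.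
have S0 : 0 <= S by apply: sumr_ge0 => k _; rewrite mulr_ge0 ?ler0n ?tail_prob_ge0.
have c0 : 0 < recurrent_count%:R :> R by rewrite ltr0n recurrent_count_gt0.
have sum_le : \sum_(y : box L | (0 < sup_norm y <= m)%N) (toppling_count y)%:R <=
    recurrent_count%:R * (12 * S).
  apply: le_trans (_ : #|recurrent_states|%:R * (12 * S) <= _); last first.
    by rewrite ler_wpM2r ?mulr_ge0 // ler_nat card_recurrent_states.
  apply: le_trans (_ : \sum_(y : box L | (0 < sup_norm y <= m)%N)
      #|recurrent_states|%:R * tail_prob (sup_norm y) <= _).
    by apply: ler_sum => y _; apply: toppling_count_le.
  rewrite -mulr_sumr ler_wpM2l ?ler0n //; apply: le_trans (sum_ball _ tail_prob_ge0) _.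
  by rewrite mulr_sumr; apply: ler_sum => k _; rewrite natrM mulrA.
have {}ball : (m%:R - 1) ^+ 2 <= 504 * m%:R * S :> R.
  rewrite -(ler_pM2l c0); apply: le_trans ball _.
  apply: le_trans (ler_wpM2l _ sum_le) _; first by rewrite mulr_ge0 ?ler0n.
  by rewrite le_eqVlt; apply/orP; left; apply/eqP; ring.
have m2 : 2 <= m%:R :> R by rewrite ler_nat.
have mpos : 0 < m%:R :> R by lra.
rewrite -(ler_pM2l mpos); nra.
Qed.

Lemma sup_norm_le_eucl y : (sup_norm y)%:R <= eucl_norm R y.
Proof.
rewrite /eucl_norm /sup_norm; set s := coord1 y; set t := coord2 y.
have sq (u v : int) : (absz u)%:R <= Num.sqrt (u%:~R ^+ 2 + v%:~R ^+ 2) :> R.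
  have -> : (absz u)%:R = `|u%:~R| :> R by rewrite -intr_norm -abszE.
  rewrite -sqrtr_sqr ler_wsqrtr // lerDl sqr_ge0 //.
have [_|_] := leqP (absz s) (absz t); last exact: sq.
by rewrite addrC; apply: sq.
Qed.

Lemma sum_reaches_le eta n :
  \sum_(1 <= k < n.+1) (reaches k eta)%:R <= avalanche_radius R eta.
Proof.
have R0 : 0 <= avalanche_radius R eta by rewrite /avalanche_radius; apply: bigmax_ge_id.
have Rk k : reaches k eta -> k%:R <= avalanche_radius R eta.
  move=> /asboolP[y ky ty]; apply: le_trans (_ : (sup_norm y)%:R <= _); first by rewrite ler_nat.
  apply: le_trans (sup_norm_le_eucl y) _.
  by rewrite /avalanche_radius; apply: le_bigmax_cond; apply/asboolP.
elim: n => [|n IH]; first by rewrite big_geq.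
have [/Rk le|/negPf nr] := boolP (reaches n.+1 eta); last first.
  by rewrite big_nat_recr //= nr addr0.
apply: le_trans le; apply: le_trans (_ : \sum_(1 <= k < n.+2) 1 <= _).
  by apply: ler_sum => k _; case: reaches.
by rewrite sumr_const_nat subn1.
Qed.

Lemma expectation_ge n : \sum_(1 <= k < n.+1) tail_prob k <=
  finite_expectation nu (@avalanche_radius R L).
Proof.
rewrite /tail_prob exchange_big /finite_expectation /=.
apply: ler_sum => eta _; rewrite -mulr_sumr ler_wpM2l ?nu_ge0 //.
exact: sum_reaches_le.
Qed.
End Expectation.

End Box.

(** * Summation by parts *)

Section Abel.
Variable R : realType.
Local Open Scope ring_scope.
Implicit Types (q : nat -> R).

Lemma sum_by_parts q n :
  \sum_(1 <= k < n.+1) q k =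
  (\sum_(1 <= k < n.+1) k%:R * q k) / n.+1%:R +
  \sum_(1 <= m < n.+1) (\sum_(1 <= k < m.+1) k%:R * q k) / (m%:R * m.+1%:R).
Proof.
elim: n => [|n IH]; first by rewrite !big_geq // mul0r addr0.
rewrite big_nat_recr //= IH [in X in _ = _ + X]big_nat_recr //=.
rewrite [X in _ = X / _ + _]big_nat_recr //=.
set S := \sum_(1 <= k < n.+1) k%:R * q k.
set T := \sum_(1 <= m < n.+1) _ / _.
rewrite [\sum_(1 <= k < n.+2) k%:R * q k]big_nat_recr //= -/S.
have n1 : n.+1%:R != 0 :> R by rewrite pnatr_eq0.
have n2 : n.+2%:R != 0 :> R by rewrite pnatr_eq0.
have e2 : n.+2%:R = n.+1%:R + 1 :> R by rewrite -natr1.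
rewrite e2 in n2 *; move: n.+1%:R n1 n2 => x x0 x1; field.
by rewrite x0 x1.
Qed.

(** Among the terms of [sum_by_parts], the one of index m is at least
    c / (m + 1). *)
Lemma harmonic_le_sum q c n : 0 <= c -> (forall k, 0 <= q k) ->
  (forall m, (1 < m <= n)%N -> c * m%:R <= \sum_(1 <= k < m.+1) k%:R * q k) ->
  c * \sum_(2 <= m < n.+1) m.+1%:R^-1 <= \sum_(1 <= k < n.+1) q k.
Proof.
move=> c0 q0 qc.
have S0 m : 0 <= \sum_(1 <= k < m.+1) k%:R * q k.
  by apply: sumr_ge0 => k _; rewrite mulr_ge0 ?ler0n.
rewrite sum_by_parts; apply: ler_wpDl; first by rewrite divr_ge0 ?ler0n.
have [n0|n0] := leqP n 0.
  by rewrite big_geq ?mulr0 ?sumr_ge0 // => [m _|]; rewrite ?divr_ge0 ?mulr_ge0 ?ler0n //; lia.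
rewrite [leRHS]big_ltn //; apply: ler_wpDl; first by rewrite divr_ge0 ?mulr_ge0 ?ler0n.
rewrite mulr_sumr; apply: ler_sum_nat => m /andP[m1 mn].
have mpos : 0 < m%:R :> R by rewrite ltr0n; lia.
rewrite invfM mulrA ler_wpM2r ?invr_ge0 ?ler0n //.
by rewrite ler_pdivlMr // qc // m1.
Qed.

End Abel.

Import numFieldNormedType.Exports.
Local Open Scope classical_set_scope.
Local Open Scope ring_scope.

Theorem proposition1p4 (R : realType) (nu : forall L : nat, stable_sandpile L -> R)
    (nu_stationary : forall L : nat, is_stationary (nu L)) :
  (fun L : nat => finite_expectation (nu L) (@avalanche_radius R L)) @ \oo --> +oo%R.
Proof.
have harmonic_dvg : series (@harmonic R) @ \oo --> +oo%R.
  apply: nondecreasing_dvgn_lt; last exact: dvg_harmonic.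
  apply/nondecreasing_seqP => n; rewrite /series /= big_nat_recr //= lerDl.
  by rewrite invr_ge0 ler0n.
apply/cvgryPge => A.
(* The harmonic sum starts at index 2, and the terms that it omits, 1 and 1/2,
   are covered by the summand 2. *)
move/cvgryPge : harmonic_dvg => /(_ (2016 * A + 2)) [n0 _ hn0].
exists n0.+1 => // L /= n0L.
apply: le_trans (expectation_ge (nu_stationary L) L).
apply: le_trans (_ : 2016^-1 * \sum_(2 <= m < L.+1) m.+1%:R^-1 <= _); last first.
  apply: harmonic_le_sum => [|k|m /andP[m1 mL]].
  - by rewrite invr_ge0 ler0n.
  - exact: (tail_prob_ge0 (nu_stationary L)).
  - rewrite ler_pdivrMl //; exact: (weighted_tail_ge (nu_stationary L)).
have L1 : (1 < L.+1)%N by lia.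
have := hn0 L.+1; rewrite /series /= (@big_cat_nat _ _ _ 2) //=.
have -> : \sum_(0 <= i < 2) i.+1%:R^-1 = 1 + 2^-1 :> R.
  by rewrite big_nat_recr //= big_nat1 invr1.
move=> /(_ (leqW (ltnW n0L))) h; rewrite ler_pdivlMl //.
move: h; set S := \sum_(2 <= m < L.+1) _; lra.
Qed.
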